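(* Let $\mathcal{B}\subseteq\mathcal{D}$ be a unital inclusion of unital $C^\ast$-algebras. Every $\mu\in\Sigma_{\mathcal{B}:\mathcal{D}}$ is boolean infinitely divisible; that is, for every positive integer $N$ there exists $\mu_N\in\Sigma_{\mathcal{B}:\mathcal{D}}$ such that $\mu$ is the additive boolean convolution of $N$ copies of $\mu_N$.
   Context: $\mathcal{B}\langle\mathcal{X}\rangle$ is the $\ast$-algebra freely generated by $\mathcal{B}$ and a selfadjoint symbol $\mathcal{X}$ ($\mathcal{B}$ and $\mathcal{X}$ are not assumed to commute). $\mathcal{B}\langle X_1,\dots,X_N\rangle$ is the $\ast$-algebra freely generated by $\mathcal{B}$ and non-commuting selfadjoint symbols $X_1,\dots,X_N$, and $\mathcal{B}\langle X_j\rangle_0$ is the $\ast$-subalgebra of polynomials in $X_j$ with coefficients in $\mathcal{B}$ without a free (constant) term. $\Sigma_{\mathcal{B}:\mathcal{D}}$ is the set of all unital positive $\mathcal{B}$-bimodule maps $\mu:\mathcal{B}\langle\mathcal{X}\rangle\to\mathcal{D}$ such that for all positive integers $n$ and all $f_1,\dots,f_n\in\mathcal{B}\langle\mathcal{X}\rangle$ one has $[\mu(f_j^\ast f_i)]_{i,j=1}^n\ge 0$ in $M_n(\mathcal{D})$. Additive boolean convolution: given $\mu_1,\dots,\mu_N\in\Sigma_{\mathcal{B}:\mathcal{D}}$, let $\Phi:\mathcal{B}\langle X_1,\dots,X_N\rangle\to\mathcal{D}$ be the unital $\mathcal{B}$-bimodule map whose restriction to $\mathcal{B}\langle X_j\rangle\cong\mathcal{B}\langle\mathcal{X}\rangle$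 is $\mu_j$ for each $j$ and such that $X_1,\dots,X_N$ are boolean independent with respect to $\Phi$, i.e. $\Phi(A_1A_2\cdots A_m)=\Phi(A_1)\Phi(A_2)\cdots\Phi(A_m)$ whenever $A_k\in\mathcal{B}\langle X_{\epsilon(k)}\rangle_0$ with $\epsilon(k)\ne\epsilon(k+1)$. The additive boolean convolution of $\mu_1,\dots,\mu_N$ is the map $\mathcal{B}\langle\mathcal{X}\rangle\to\mathcal{D}$ obtained by composing $\Phi$ with the homomorphism $\mathcal{B}\langle\mathcal{X}\rangle\to\mathcal{B}\langle X_1,\dots,X_N\rangle$ that fixes $\mathcal{B}$ and sends $\mathcal{X}$ to $X_1+\dots+X_N$. *)

(* Defs.v *)
From HB Require Import structures.
From mathcomp Require Import all_boot all_order all_algebra.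
From mathcomp Require Import generic_quotient.
From mathcomp Require Import boolp reals.
From mathcomp Require Import complex.

Set Implicit Arguments.
Unset Strict Implicit.
Unset Printing Implicit Defensive.

Import Order.TTheory GRing.Theory Num.Theory.

Local Open Scope ring_scope.
Local Open Scope quotient_scope.
Local Open Scope complex_scope.

HB.mixin Record Algebra_isStarAlgebra (C : numClosedFieldType) A
    of GRing.Algebra C A := {
  star : A -> A;
  starK : involutive star;
  starD : {morph star : x y / x + y};
  starZ : forall (c : C) x, star (c *: x) = (c^* )%R *: star x;
  starM : forall x y, star (x * y) = star y * star x
}.

#[short(type="starAlgType")]
HB.structure Definition StarAlgebra (C : numClosedFieldType) :=
  {A of GRing.Algebra C A & Algebra_isStarAlgebra C A}.

(* Normed algebras cannot be obtained by joining [GRing.Algebra] with the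
   library's normed modules: the packed hierarchy has no common ancestor for
   this join and [numDomainType].  The norm and its completeness are therefore
   fields of the mixin. *)
HB.mixin Record StarAlgebra_isCStarAlgebra (R : realType) A
    of StarAlgebra R[i] A := {
  cnorm : A -> R;
  cnorm0_eq0 : forall x, cnorm x = 0 -> x = 0;
  cnormD : forall x y, cnorm (x + y) <= cnorm x + cnorm y;
  cnormZ : forall (c : R[i]) x, cnorm (c *: x) = Normc.normc c * cnorm x;
  cnormM : forall x y, cnorm (x * y) <= cnorm x * cnorm y;
  cnorm_star : forall x, cnorm (star x * x) = cnorm x ^+ 2;
  cnorm_complete : forall u : nat -> A,
    (forall e : R, 0 < e -> exists K : nat, forall m n : nat,
      (K <= m)%N -> (K <= n)%N -> cnorm (u m - u n) < e) ->
    exists l : A, forall e : R, 0 < e -> exists K : nat, forall n : nat,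
      (K <= n)%N -> cnorm (u n - l) < e
}.

#[short(type="cstarAlgType")]
HB.structure Definition CStarAlgebra (R : realType) :=
  {A of StarAlgebra R[i] A & StarAlgebra_isCStarAlgebra R A}.

Inductive fterm (B I : Type) : Type :=
| FVar of I
| FConst of B
| FAdd of fterm B I & fterm B I
| FMul of fterm B I & fterm B I.
Arguments FVar {B I}.
Arguments FConst {B I}.

HB.instance Definition _ (B I : Type) := gen_eqMixin (fterm B I).
HB.instance Definition _ (B I : Type) := gen_choiceMixin (fterm B I).

(* The least congruence for which the quotient is a unital C-algebra in which
   [FConst] is a unital algebra morphism.  Opposites and scalar multiples are
   products with the constants [- 1] and [c%:A]. *)
Inductive feq (C : numClosedFieldType) (B : algType C) (I : Type) :
    fterm B I -> fterm B I -> Prop :=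
| feq_refl t : feq t t
| feq_sym s t : feq s t -> feq t s
| feq_trans s t u : feq s t -> feq t u -> feq s u
| feq_add s s' t t' : feq s s' -> feq t t' -> feq (FAdd s t) (FAdd s' t')
| feq_mul s s' t t' : feq s s' -> feq t t' -> feq (FMul s t) (FMul s' t')
| feq_addA s t u : feq (FAdd s (FAdd t u)) (FAdd (FAdd s t) u)
| feq_addC s t : feq (FAdd s t) (FAdd t s)
| feq_add0 t : feq (FAdd (FConst 0) t) t
| feq_mulA s t u : feq (FMul s (FMul t u)) (FMul (FMul s t) u)
| feq_mul1l t : feq (FMul (FConst 1) t) t
| feq_mul1r t : feq (FMul t (FConst 1)) t
| feq_mulDl s t u : feq (FMul (FAdd s t) u) (FAdd (FMul s u) (FMul t u))
| feq_mulDr s t u : feq (FMul s (FAdd t u)) (FAdd (FMul s t) (FMul s u))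
| feq_mul0 t : feq (FMul (FConst 0) t) (FConst 0)
| feq_constD b b' : feq (FAdd (FConst b) (FConst b')) (FConst (b + b'))
| feq_constM b b' : feq (FMul (FConst b) (FConst b')) (FConst (b * b'))
| feq_scalar (c : C) t :
    feq (FMul (FConst c%:A) t) (FMul t (FConst c%:A)).

Section FreeAlgebra.
Variables (C : numClosedFieldType) (B : algType C) (I : Type).

Definition feqb : rel (fterm B I) := fun s t => `[< feq s t >].

Lemma feqb_refl : reflexive feqb.
Proof. by move=> t; apply/asboolP/feq_refl. Qed.

Lemma feqb_sym : symmetric feqb.
Proof. by move=> s t; apply/asboolP/asboolP => /feq_sym. Qed.

Lemma feqb_trans : transitive feqb.
Proof.
by move=> t s u /asboolP st /asboolP tu; apply/asboolP; apply: feq_trans st tu.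
Qed.

Canonical feqb_equiv := EquivRel feqb feqb_refl feqb_sym feqb_trans.

Definition freeAlg : Type := {eq_quot feqb_equiv}.
HB.instance Definition _ := Choice.on freeAlg.
HB.instance Definition _ := EqQuotient.on freeAlg.

Lemma eq_freeAlg (s t : fterm B I) : \pi_freeAlg s = \pi_freeAlg t <-> feq s t.
Proof.
split=> [/eqP|st]; first by rewrite eqmodE => /asboolP.
by apply/eqP; rewrite eqmodE; apply/asboolP.
Qed.

Lemma feq_repr (t : fterm B I) : feq (repr (\pi_freeAlg t)) t.
Proof. by apply/eq_freeAlg; rewrite reprK. Qed.

Definition fa_var (i : I) : freeAlg := \pi_freeAlg (FVar i).
Definition fa_const (b : B) : freeAlg := \pi_freeAlg (FConst b).
Definition fa_add (x y : freeAlg) := \pi_freeAlg (FAdd (repr x) (repr y)).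
Definition fa_mul (x y : freeAlg) := \pi_freeAlg (FMul (repr x) (repr y)).
Definition fa_opp (x : freeAlg) := fa_mul (fa_const (-1)) x.
Definition fa_scale (c : C) (x : freeAlg) := fa_mul (fa_const c%:A) x.

Lemma pi_add s t : fa_add (\pi s) (\pi t) = \pi_freeAlg (FAdd s t).
Proof. by apply/eq_freeAlg/feq_add; apply: feq_repr. Qed.

Lemma pi_mul s t : fa_mul (\pi s) (\pi t) = \pi_freeAlg (FMul s t).
Proof. by apply/eq_freeAlg/feq_mul; apply: feq_repr. Qed.

Lemma fa_addA : associative fa_add.
Proof.
elim/quotW=> s; elim/quotW=> t; elim/quotW=> u; rewrite !pi_add.
exact/eq_freeAlg/feq_addA.
Qed.

Lemma fa_addC : commutative fa_add.
Proof.
by elim/quotW=> s; elim/quotW=> t; rewrite !pi_add; apply/eq_freeAlg/feq_addC.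
Qed.

Lemma fa_add0 : left_id (fa_const 0) fa_add.
Proof. by elim/quotW=> t; rewrite pi_add; apply/eq_freeAlg/feq_add0. Qed.

Lemma fa_mulDl : left_distributive fa_mul fa_add.
Proof.
elim/quotW=> s; elim/quotW=> t; elim/quotW=> u; rewrite !(pi_add, pi_mul).
exact/eq_freeAlg/feq_mulDl.
Qed.

Lemma fa_mulDr : right_distributive fa_mul fa_add.
Proof.
elim/quotW=> s; elim/quotW=> t; elim/quotW=> u; rewrite !(pi_add, pi_mul).
exact/eq_freeAlg/feq_mulDr.
Qed.

Lemma fa_mulA : associative fa_mul.
Proof.
elim/quotW=> s; elim/quotW=> t; elim/quotW=> u; rewrite !pi_mul.
exact/eq_freeAlg/feq_mulA.
Qed.

Lemma fa_mul1l : left_id (fa_const 1) fa_mul.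
Proof. by elim/quotW=> t; rewrite pi_mul; apply/eq_freeAlg/feq_mul1l. Qed.

Lemma fa_mul1r : right_id (fa_const 1) fa_mul.
Proof. by elim/quotW=> t; rewrite pi_mul; apply/eq_freeAlg/feq_mul1r. Qed.

Lemma fa_mul0 : left_zero (fa_const 0) fa_mul.
Proof. by elim/quotW=> t; rewrite pi_mul; apply/eq_freeAlg/feq_mul0. Qed.

Lemma fa_constD b b' : fa_add (fa_const b) (fa_const b') = fa_const (b + b').
Proof. by rewrite pi_add; apply/eq_freeAlg/feq_constD. Qed.

Lemma fa_constM b b' : fa_mul (fa_const b) (fa_const b') = fa_const (b * b').
Proof. by rewrite pi_mul; apply/eq_freeAlg/feq_constM. Qed.

Lemma fa_scalarC (c : C) x :
  fa_mul (fa_const c%:A) x = fa_mul x (fa_const c%:A).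
Proof.
by elim/quotW: x => t; rewrite !pi_mul; apply/eq_freeAlg/feq_scalar.
Qed.

Lemma fa_addN : left_inverse (fa_const 0) fa_opp fa_add.
Proof.
move=> x; rewrite -{2}[x]fa_mul1l /fa_opp -fa_mulDl fa_constD addNr.
exact: fa_mul0.
Qed.

HB.instance Definition _ :=
  GRing.isZmodule.Build freeAlg fa_addA fa_addC fa_add0 fa_addN.

Fixpoint feval (A : algType C) (phi : B -> A) (x : I -> A) (t : fterm B I) : A :=
  match t with
  | FVar i => x i
  | FConst b => phi b
  | FAdd s u => feval phi x s + feval phi x u
  | FMul s u => feval phi x s * feval phi x u
  end.

Lemma feval_feq (A : algType C) (phi : {lrmorphism B -> A}) (x : I -> A) s t :
  feq s t -> feval phi x s = feval phi x t.
Proof.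
elim=> //= {s t}.
- by move=> s t u _ -> _ ->.
- by move=> s s' t t' _ -> _ ->.
- by move=> s s' t t' _ -> _ ->.
- by move=> s t u; rewrite addrA.
- by move=> s t; rewrite addrC.
- by move=> t; rewrite rmorph0 add0r.
- by move=> s t u; rewrite mulrA.
- by move=> t; rewrite rmorph1 mul1r.
- by move=> t; rewrite rmorph1 mulr1.
- by move=> s t u; rewrite mulrDl.
- by move=> s t u; rewrite mulrDr.
- by move=> t; rewrite rmorph0 mul0r.
- by move=> b b'; rewrite rmorphD.
- by move=> b b'; rewrite rmorphM.
- by move=> c t; rewrite linearZ /= rmorph1 mulr_algl mulr_algr.
Qed.

Lemma fa_1neq0 : fa_const 1 != 0.
Proof.
apply/eqP => /eq_freeAlg /(@feval_feq B idfun (fun=> 0)) /= /eqP.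
by rewrite oner_eq0.
Qed.

HB.instance Definition _ := GRing.Zmodule_isNzRing.Build freeAlg
  fa_mulA fa_mul1l fa_mul1r fa_mulDl fa_mulDr fa_1neq0.

Lemma fa_scaleA a b v : fa_scale a (fa_scale b v) = fa_scale (a * b) v.
Proof. by rewrite /fa_scale fa_mulA fa_constM mulr_algl scalerA. Qed.

Lemma fa_scale1 : left_id 1 fa_scale.
Proof. by move=> v; rewrite /fa_scale scale1r; apply: fa_mul1l. Qed.

Lemma fa_scaleDr : right_distributive fa_scale +%R.
Proof. by move=> a u v; apply: fa_mulDr. Qed.

Lemma fa_scaleDl v : {morph fa_scale^~ v : a b / a + b}.
Proof. by move=> a b; rewrite /fa_scale scalerDl -fa_constD; apply: fa_mulDl. Qed.

HB.instance Definition _ := GRing.Zmodule_isLmodule.Build C freeAlg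
  fa_scaleA fa_scale1 fa_scaleDr fa_scaleDl.

Lemma fa_scaleAl (a : C) (u v : freeAlg) : a *: (u * v) = (a *: u) * v.
Proof. exact: fa_mulA. Qed.

HB.instance Definition _ := GRing.Lmodule_isLalgebra.Build C freeAlg fa_scaleAl.

Lemma fa_scaleAr (a : C) (u v : freeAlg) : a *: (u * v) = u * (a *: v).
Proof.
change (fa_mul (fa_const a%:A) (fa_mul u v)
  = fa_mul u (fa_mul (fa_const a%:A) v)).
by rewrite fa_mulA fa_scalarC -fa_mulA.
Qed.

HB.instance Definition _ := GRing.Lalgebra_isAlgebra.Build C freeAlg fa_scaleAr.

Fact fa_const_zmod_morphism : zmod_morphism fa_const.
Proof.
have cD b b' : fa_const (b + b') = fa_const b + fa_const b'.
  exact/esym/fa_constD.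
by move=> b b'; apply: (addIr (fa_const b')); rewrite -cD !subrK.
Qed.

Fact fa_const_monoid_morphism : monoid_morphism fa_const.
Proof. by split=> // b b'; apply/esym/fa_constM. Qed.

Fact fa_const_scalable : scalable fa_const.
Proof. by move=> c b; rewrite -mulr_algl -fa_constM. Qed.

HB.instance Definition _ :=
  GRing.isZmodMorphism.Build B freeAlg fa_const fa_const_zmod_morphism.
HB.instance Definition _ :=
  GRing.isMonoidMorphism.Build B freeAlg fa_const fa_const_monoid_morphism.
HB.instance Definition _ :=
  GRing.isScalable.Build C B freeAlg *:%R fa_const fa_const_scalable.

Lemma freeAlg_ind (P : freeAlg -> Prop) :
  (forall i, P (fa_var i)) -> (forall b, P (fa_const b)) ->
  (forall f g, P f -> P g -> P (f + g)) ->
  (forall f g, P f -> P g -> P (f * g)) -> forall f, P f.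
Proof.
move=> Pv Pc Pa Pm; elim/quotW; elim=> [i|b|s Ps t Pt|s Ps t Pt].
- exact: Pv.
- exact: Pc.
- by rewrite -pi_add; apply: Pa.
- by rewrite -pi_mul; apply: Pm.
Qed.

End FreeAlgebra.

Arguments fa_var {C B I}.
Arguments fa_const {C B I}.

Section FreeStar.
Variables (C : numClosedFieldType) (B : starAlgType C) (I : Type).

Fixpoint fterm_star (t : fterm B I) : fterm B I :=
  match t with
  | FVar i => FVar i
  | FConst b => FConst (star b)
  | FAdd s u => FAdd (fterm_star s) (fterm_star u)
  | FMul s u => FMul (fterm_star u) (fterm_star s)
  end.

Lemma star0 (A : starAlgType C) : star (0 : A) = 0.
Proof. by apply: (addIr (star 0)); rewrite -starD !add0r. Qed.

Lemma star1 (A : starAlgType C) : star (1 : A) = 1.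
Proof. by rewrite -[LHS]mul1r -{1}(starK 1) -starM mul1r starK. Qed.

Lemma fterm_starK : involutive fterm_star.
Proof. by elim=> [i|b|s Es t Et|s Es t Et] //=; rewrite ?starK ?Es ?Et. Qed.

Lemma fterm_star_feq s t : feq s t -> feq (fterm_star s) (fterm_star t).
Proof.
elim=> /= {s t}.
- by move=> t; apply: feq_refl.
- by move=> s t _; apply: feq_sym.
- by move=> s t u _ st _; apply: feq_trans st.
- by move=> s s' t t' _ ss' _; apply: feq_add.
- by move=> s s' t t' _ ss' _ tt'; apply: feq_mul.
- by move=> s t u; apply: feq_addA.
- by move=> s t; apply: feq_addC.
- by move=> t; rewrite star0; apply: feq_add0.
- by move=> s t u; apply/feq_sym/feq_mulA.
- by move=> t; rewrite star1; apply: feq_mul1r.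
- by move=> t; rewrite star1; apply: feq_mul1l.
- by move=> s t u; apply: feq_mulDr.
- by move=> s t u; apply: feq_mulDl.
- move=> t; rewrite star0.
  apply: (@feq_trans _ _ _ _ (FMul (FConst 0) (fterm_star t)));
    last exact: feq_mul0.
  by rewrite -(scale0r (1 : B)); apply/feq_sym/feq_scalar.
- by move=> b b'; rewrite starD; apply: feq_constD.
- by move=> b b'; rewrite starM; apply: feq_constM.
- by move=> c t; rewrite starZ star1; apply/feq_sym/feq_scalar.
Qed.

Definition fa_star (x : freeAlg B I) : freeAlg B I :=
  \pi_(freeAlg B I) (fterm_star (repr x)).

Lemma pi_star s : fa_star (\pi s) = \pi_(freeAlg B I) (fterm_star s).
Proof. by apply/eq_freeAlg/fterm_star_feq/feq_repr. Qed.

Lemma fa_starK : involutive fa_star.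
Proof. by elim/quotW=> t; rewrite !pi_star fterm_starK. Qed.

Lemma fa_starD : {morph fa_star : x y / x + y}.
Proof.
elim/quotW=> s; elim/quotW=> t.
by rewrite [_ + _]pi_add !pi_star [RHS]pi_add.
Qed.

Lemma fa_starM x y : fa_star (x * y) = fa_star y * fa_star x.
Proof.
elim/quotW: x => s; elim/quotW: y => t.
by rewrite [_ * _]pi_mul !pi_star [RHS]pi_mul.
Qed.

Lemma fa_starZ (c : C) x : fa_star (c *: x) = (c^* )%R *: fa_star x.
Proof.
rewrite -[in LHS]mulr_algl -[RHS]mulr_algr fa_starM; congr (_ * _).
have cE (d : C) : (d%:A : freeAlg B I) = fa_const d%:A by rewrite linearZ.
by rewrite !cE pi_star /= starZ star1.
Qed.

HB.instance Definition _ := Algebra_isStarAlgebra.Build C (freeAlg B I)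
  fa_starK fa_starD fa_starZ fa_starM.

Lemma star_var i : star (fa_var i : freeAlg B I) = fa_var i.
Proof. exact: pi_star. Qed.

Lemma star_const b : star (fa_const b : freeAlg B I) = fa_const (star b).
Proof. exact: pi_star. Qed.

End FreeStar.

Section FreeLift.
Variables (C : numClosedFieldType) (B : algType C) (I : Type) (A : algType C).
Variables (phi : {lrmorphism B -> A}) (x : I -> A).

Definition fa_lift (f : freeAlg B I) : A := feval phi x (repr f).

Lemma fa_lift_pi t : fa_lift (\pi t) = feval phi x t.
Proof. exact/feval_feq/feq_repr. Qed.

Lemma fa_lift_var i : fa_lift (fa_var i) = x i.
Proof. exact: fa_lift_pi. Qed.

Lemma fa_lift_const b : fa_lift (fa_const b) = phi b.
Proof. exact: fa_lift_pi. Qed.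

Lemma fa_liftD f g : fa_lift (f + g) = fa_lift f + fa_lift g.
Proof.
elim/quotW: f => s; elim/quotW: g => t.
by rewrite [_ + _]pi_add !fa_lift_pi.
Qed.

Lemma fa_liftM f g : fa_lift (f * g) = fa_lift f * fa_lift g.
Proof.
elim/quotW: f => s; elim/quotW: g => t.
by rewrite [_ * _]pi_mul !fa_lift_pi.
Qed.

Fact fa_lift_zmod_morphism : zmod_morphism fa_lift.
Proof. by move=> f g; apply: (addIr (fa_lift g)); rewrite -fa_liftD !subrK. Qed.

Fact fa_lift_monoid_morphism : monoid_morphism fa_lift.
Proof.
split=> [|f g]; last exact: fa_liftM.
by rewrite -[1]/(fa_const 1) fa_lift_const rmorph1.
Qed.

Fact fa_lift_scalable : scalable fa_lift.
Proof.
move=> c f; rewrite -[c *: f]/(fa_const c%:A * f) fa_liftM fa_lift_const.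
by rewrite linearZ /= rmorph1 mulr_algl.
Qed.

HB.instance Definition _ :=
  GRing.isZmodMorphism.Build (freeAlg B I) A fa_lift fa_lift_zmod_morphism.
HB.instance Definition _ :=
  GRing.isMonoidMorphism.Build (freeAlg B I) A fa_lift fa_lift_monoid_morphism.
HB.instance Definition _ :=
  GRing.isScalable.Build C (freeAlg B I) A *:%R fa_lift fa_lift_scalable.

Lemma fa_lift_unique (psi : {lrmorphism freeAlg B I -> A}) :
  (forall b, psi (fa_const b) = phi b) -> (forall i, psi (fa_var i) = x i) ->
  psi =1 fa_lift.
Proof.
move=> psic psiv; elim/freeAlg_ind=> [i|b|f g ef eg|f g ef eg].
- by rewrite psiv fa_lift_var.
- by rewrite psic fa_lift_const.
- by rewrite rmorphD /= ef eg fa_liftD.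
- by rewrite rmorphM /= ef eg fa_liftM.
Qed.

End FreeLift.

(* [B<X>] and [B<X_1, ..., X_N>] *)
Notation ncpoly B := (freeAlg B unit).
Notation ncpolyn B N := (freeAlg B 'I_N).

Definition mx_star (C : numClosedFieldType) (A : starAlgType C) (m n : nat)
  (M : 'M[A]_(m, n)) : 'M[A]_(n, m) := (map_mx star M)^T.

(* Positivity in the C*-algebras [A] and [M_n(A)]: the positive elements are
   those of the form [x^* x]. *)
Definition is_pos (C : numClosedFieldType) (A : starAlgType C) (a : A) : Prop :=
  exists x : A, a = star x * x.
Definition mx_is_pos (C : numClosedFieldType) (A : starAlgType C) (n : nat)
  (M : 'M[A]_n) : Prop := exists Z : 'M[A]_n, M = mx_star Z *m Z.

Section Distributions.
Variables (R : realType) (B D : cstarAlgType R) (iota : {lrmorphism B -> D}).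

Definition bimodule_map (I : Type) (mu : freeAlg B I -> D) : Prop :=
  linear mu /\
  forall b f b', mu (fa_const b * f * fa_const b') = iota b * mu f * iota b'.

(* The entry [mu (f_j^* f_i)] is in row [j] and column [i]; with the transposed
   reading there would be no such [mu] at all for, e.g., [B = D = M_2(C)] (take
   the constants [f_1 = e_11] and [f_2 = e_12]). *)
Definition Sigma (mu : ncpoly B -> D) : Prop :=
  [/\ bimodule_map mu, mu 1 = 1,
      forall f, is_pos (mu (star f * f)) &
      forall (n : nat) (f : 'I_n -> ncpoly B), (0 < n)%N ->
        mx_is_pos (\matrix_(j, i) mu (star (f j) * f i))].

Definition subst_var (N : nat) (j : 'I_N) : ncpoly B -> ncpolyn B N :=
  fa_lift fa_const (fun=> fa_var j).

Definition subst_sum (N : nat) : ncpoly B -> ncpolyn B N :=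
  fa_lift fa_const (fun=> \sum_(j < N) fa_var j).

(* [b_0 X_j b_1 X_j b_2 ... X_j b_n] with [bs = [:: b_1; ...; b_n]] *)
Definition monomial (N : nat) (j : 'I_N) (b0 : B) (bs : seq B) : ncpolyn B N :=
  fa_const b0 * \prod_(b <- bs) (fa_var j * fa_const b).

Definition no_free_term (N : nat) (j : 'I_N) (f : ncpolyn B N) : Prop :=
  exists2 ws : seq (B * seq B), all (fun w => w.2 != [::]) ws &
    f = \sum_(w <- ws) monomial j w.1 w.2.

Definition boolean_independent (N : nat) (Phi : ncpolyn B N -> D) : Prop :=
  forall (m : nat) (eps : 'I_m -> 'I_N) (A : 'I_m -> ncpolyn B N),
    (0 < m)%N ->
    (forall k l : 'I_m, l = k.+1 :> nat -> eps k != eps l) ->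
    (forall k, no_free_term (eps k) (A k)) ->
    Phi (\prod_(k < m) A k) = \prod_(k < m) Phi (A k).

Definition is_boolean_convolution (N : nat) (mus : 'I_N -> ncpoly B -> D)
    (nu : ncpoly B -> D) : Prop :=
  exists Phi : ncpolyn B N -> D,
    [/\ bimodule_map Phi /\ Phi 1 = 1,
        forall j f, Phi (subst_var j f) = mus j f,
        boolean_independent Phi &
        forall f, nu f = Phi (subst_sum N f)].

End Distributions.

(* Main.v *)
From HB Require Import structures.
Require Import Defs.
From mathcomp Require Import all_boot all_order all_algebra.
From mathcomp Require Import boolp classical_sets reals complex ring lra.

(** Let [t = 1 / N].  Completing the span of [B<X>] against [D] for the form
    [<f d, g e> = star d * mu (star f * g) * e] gives a Hilbert module on which
    [X] is symmetric, and [mu f = <1, f 1>].  Let [P] be the projection on the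
    line of the vacuum vector [1].  The boolean convolution power of exponent
    [t] is obtained by keeping the module and the left action of [B], and
    replacing [X] by [X (1 - (1 - t) P)]: this multiplies all boolean cumulants
    by [t].  The new operator is symmetric for the form
    [N <u, v> - (N - 1) <u, 1> <1, v>], which is [<u, v>] on the vacuum line
    and [N <u, v>] on its orthogonal, hence is again positive.  So the new
    vacuum state [muN] is completely positive ([vacuum_state_Sigma]).

    For the convolution, [N] copies of the model are glued along the vacuum, the
    variable of index [j] acting on the copy of index [j] and killing the
    orthogonal of the vacuum in the others.  Products alternating between the
    copies then factor at the vacuum ([vacuum_state_independent]), and the map
    [t + (1 - t) P], placed in all copies at once, intertwines the original [X]
    with the sum of the variables ([act_subst_sum]), so that the sum has
    distribution [mu].

    No completion is performed: a vector [u] is represented by the map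
    [g |-> <1, g u>] from [B<X>] to [D], on which [X] and [B] act by right
    translation, and sums of elementary tensors by finite lists.

    Complete positivity comes out as the fact that each matrix
    [[muN (star (f j) * f i)]] is [star W * W] for a rectangular matrix [W] over
    [D], while membership in [Sigma] asks for a square factor.  This is a
    statement on C*-algebras ([mx_gram_pos]): [A = star W * W] has a
    self-adjoint square root in the matrix algebra.  The root is the sum of the
    series of [sqrt (1 - z)] at [z = 1 - A / c].  With a large scalar [c], [z]
    is a contraction for the [D]-valued inner product on columns, so its powers
    have bounded entries, and this suffices for convergence because the
    coefficients of the series are nonnegative with bounded sum.  The
    comparison of columns uses that the elements [star x * x] of [D] form a
    convex cone, which is the theorem of Fukamiya, Kelley, Vaught and Kaplansky
    ([cpos_star_mul]). *)

Set Implicit Arguments.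
Unset Strict Implicit.
Unset Printing Implicit Defensive.

Import Order.TTheory GRing.Theory Num.Theory.

Local Open Scope ring_scope.
Local Open Scope complex_scope.

(** * A square root series with nonnegative coefficients *)

Section SqrtPoly.
Variable R : realType.

(** Iterates from [0] of the map [y |-> (z + y ^ 2) / 2], whose fixed point is
    [1 - sqrt (1 - z)].  Their coefficients being nonnegative, norms of their
    values are controlled by their values at [1]. *)
Fixpoint sqrt_poly (n : nat) : {poly R} :=
  if n is m.+1 then (2^-1)%:P * ('X + sqrt_poly m ^+ 2) else 0.

Definition nneg_coefs (p : {poly R}) := forall i, 0 <= p`_i.

Lemma nneg_coefsD p q :
  nneg_coefs p -> nneg_coefs q -> nneg_coefs (p + q).
Proof. by move=> p0 q0 i; rewrite coefD addr_ge0. Qed.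

Lemma nneg_coefsM p q :
  nneg_coefs p -> nneg_coefs q -> nneg_coefs (p * q).
Proof. by move=> p0 q0 i; rewrite coefM sumr_ge0 // => j _; rewrite mulr_ge0. Qed.

Lemma nneg_coefsC (c : R) : 0 <= c -> nneg_coefs c%:P.
Proof. by move=> c0 i; rewrite coefC; case: ifP. Qed.

Lemma nneg_coefs_sqrt_poly n : nneg_coefs (sqrt_poly n).
Proof.
elim: n => [|n IH] /=; first by move=> i; rewrite coef0.
apply: nneg_coefsM; first by apply: nneg_coefsC; rewrite invr_ge0 ler0n.
apply: nneg_coefsD; last by rewrite expr2; apply: nneg_coefsM.
by move=> i; rewrite coefX ler0n.
Qed.

(** Two successive differences are related by the factorization of a
    difference of squares, so nonnegativity propagates. *)
Lemma nneg_coefs_sqrt_polyS n : nneg_coefs (sqrt_poly n.+1 - sqrt_poly n).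
Proof.
elim: n => [|n IH]; first by rewrite subr0; apply: nneg_coefs_sqrt_poly.
have -> : sqrt_poly n.+2 - sqrt_poly n.+1 = (2^-1)%:P *
    ((sqrt_poly n.+1 + sqrt_poly n) * (sqrt_poly n.+1 - sqrt_poly n)).
  by rewrite [sqrt_poly n.+2]/= {4}/sqrt_poly -/sqrt_poly /=; ring.
apply: nneg_coefsM; first by apply: nneg_coefsC; rewrite invr_ge0 ler0n.
by apply: nneg_coefsM => //; apply: nneg_coefsD; apply: nneg_coefs_sqrt_poly.
Qed.

Lemma nneg_coefs_sqrt_polyB m n :
  (m <= n)%N -> nneg_coefs (sqrt_poly n - sqrt_poly m).
Proof.
move=> /subnK <-; elim: (n - m)%N => [|k IH].
  by rewrite subrr => i; rewrite coef0.
rewrite addSn -[_ - _](subrKA (sqrt_poly (k + m))).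
by apply: nneg_coefsD => //; apply: nneg_coefs_sqrt_polyS.
Qed.

Lemma nneg_coefs_horner1 p : nneg_coefs p -> 0 <= p.[1].
Proof.
by move=> p0; rewrite horner_coef sumr_ge0 // => i _; rewrite expr1n mulr1.
Qed.

Lemma sqrt_poly1_le1 n : (sqrt_poly n).[1] <= 1.
Proof.
elim: n => [|n IH]; first by rewrite horner0.
have := nneg_coefs_horner1 (nneg_coefs_sqrt_poly n).
rewrite /= !hornerE; nra.
Qed.

(** The values at [1] increase and do not exceed the fixed point [1]. *)
Lemma sqrt_poly1_cauchy (e : R) : 0 < e -> exists K : nat, forall m n : nat,
  (K <= m)%N -> (m <= n)%N -> (sqrt_poly n - sqrt_poly m).[1] < e.
Proof.
move=> e0; pose S := [set x : R | exists n, x = (sqrt_poly n).[1]]%classic.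
have supS : has_sup S.
  split; first by exists (sqrt_poly 0).[1]; exists 0%N.
  by exists 1 => x [n ->]; apply: sqrt_poly1_le1.
have [_ [K ->] ltK] := sup_adherent e0 supS.
exists K => m n leKm lemn; rewrite hornerD hornerN.
have : (sqrt_poly n).[1] <= sup S by apply: sup_upper_bound => //; exists n.
have := nneg_coefs_horner1 (nneg_coefs_sqrt_polyB leKm).
rewrite hornerD hornerN; lra.
Qed.

End SqrtPoly.

(** What the square root series uses of a real Banach algebra.  It applies to
    [D] and also to matrices over [D] with the sum of the norms of the entries,
    which saves constructing the C*-norm of the matrix algebra. *)
Record banach_norm (R : realType) (E : nzRingType) (c : {rmorphism R -> E})
    (nu : E -> R) : Prop := BanachNorm {
  bn_central : forall r x, c r * x = x * c r;
  bn_eq0 : forall x, nu x = 0 -> x = 0;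
  bn_triangle : forall x y, nu (x + y) <= nu x + nu y;
  bn_scale : forall r x, nu (c r * x) = `|r| * nu x;
  bn_mul : forall x y, nu (x * y) <= nu x * nu y;
  bn_complete : forall u : nat -> E,
    (forall e : R, 0 < e -> exists K : nat, forall m n : nat,
      (K <= m)%N -> (K <= n)%N -> nu (u m - u n) < e) ->
    exists l : E, forall e : R, 0 < e -> exists K : nat, forall n : nat,
      (K <= n)%N -> nu (u n - l) < e
}.

Section BanachSqrt.
Variables (R : realType) (E : nzRingType) (c : {rmorphism R -> E}).
Variables (nu : E -> R) (bn : banach_norm c nu).

Lemma bn_norm0 : nu 0 = 0.
Proof. by rewrite -[0](mul0r 0) -(rmorph0 c) (bn_scale bn) normr0 mul0r. Qed.

Lemma bn_normN x : nu (- x) = nu x.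
Proof.
by rewrite -mulN1r -(rmorph1 c) -rmorphN (bn_scale bn) normrN1 mul1r.
Qed.

Lemma bn_distC x y : nu (x - y) = nu (y - x).
Proof. by rewrite -bn_normN opprB. Qed.

Lemma bn_norm_ge0 x : 0 <= nu x.
Proof.
have := bn_triangle bn x (- x); rewrite subrr bn_norm0 bn_normN.
by rewrite -mulr2n pmulrn_lge0.
Qed.

Lemma bn_norm_sum (I : Type) (r : seq I) (F : I -> E) :
  nu (\sum_(i <- r) F i) <= \sum_(i <- r) nu (F i).
Proof.
elim: r => [|i r IH]; first by rewrite !big_nil bn_norm0.
by rewrite !big_cons (le_trans (bn_triangle bn _ _)) // lerD2l.
Qed.

Lemma bn_eq_small x : (forall e, 0 < e -> nu x < e) -> x = 0.
Proof.
move=> small; apply: (bn_eq0 bn); apply/eqP.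
rewrite eq_le bn_norm_ge0 andbT leNgt; apply/negP => /small.
by rewrite ltxx.
Qed.

(** Transfers the self-adjointness of polynomials in [z] to their limit, with
    the involution as [sigma]. *)
Lemma bn_fixed_limit (sigma : E -> E) (y : E) (P : E -> Prop) :
  {morph sigma : a b / a - b} -> (forall a, nu (sigma a) = nu a) ->
  (forall a, P a -> sigma a = a) ->
  (forall e, 0 < e -> exists2 a, P a & nu (y - a) < e) -> sigma y = y.
Proof.
move=> sigmaB sigma_iso fixP appr; apply/eqP; rewrite -subr_eq0.
apply/eqP/bn_eq_small => e e0.
have /appr[a Pa lta] : 0 < e / 2 by rewrite divr_gt0.
have -> : sigma y - y = sigma (y - a) - (y - a).
  by rewrite sigmaB (fixP a Pa) opprB addrA subrK.
rewrite (le_lt_trans (bn_triangle bn _ _)) // bn_normN sigma_iso [e]splitr.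
by rewrite ltrD.
Qed.

Variables (z : E) (K : R).

Lemma bn_commr_rmorph : commr_rmorph c z.
Proof. by move=> r; rewrite /GRing.comm (bn_central bn). Qed.

Definition bn_eval : {poly R} -> E := horner_morph bn_commr_rmorph.
HB.instance Definition _ := GRing.RMorphism.on bn_eval.

Lemma bn_evalE p : bn_eval p = \sum_(i < size p) c p`_i * z ^+ i.
Proof.
rewrite /bn_eval /horner_morph /= (@horner_coef_wide _ (size p)).
  by apply: eq_bigr => i _; rewrite coef_map.
exact: size_poly.
Qed.

Hypothesis powz : forall k, nu (z ^+ k) <= K.

(** The triangle inequality, since nonnegative coefficients add up to the value
    at [1]. *)
Lemma bn_eval_le p : nneg_coefs p -> nu (bn_eval p) <= K * p.[1].
Proof.
move=> p0; rewrite bn_evalE (le_trans (bn_norm_sum _ _)) //.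
rewrite horner_coef mulr_sumr ler_sum // => i _.
rewrite (bn_scale bn) expr1n mulr1 ger0_norm // mulrC.
by rewrite ler_wpM2r.
Qed.

(** The square root of [1 - z] is [1 - y], where [y] is the limit of the
    iterates.  Asking for bounded powers instead of [nu z <= 1] makes the result
    independent of the choice of an equivalent norm, which matters for
    matrices. *)
Theorem bn_sqrt : exists y : E,
  [/\ (1 - y) * (1 - y) = 1 - z, nu y <= K &
      forall e, 0 < e -> exists2 a, (exists p, a = bn_eval p) & nu (y - a) < e].
Proof.
have K_ge0 : 0 <= K by apply: le_trans (powz 0); apply: bn_norm_ge0.
pose u n := bn_eval (sqrt_poly R n).
have cauchy e : 0 < e -> exists K : nat, forall m n : nat,
    (K <= m)%N -> (K <= n)%N -> nu (u m - u n) < e.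
  move=> e0; have e1 : 0 < e / (K + 1) by rewrite divr_gt0 ?ltr_wpDl.
  have [M ltM] := sqrt_poly1_cauchy e1; exists M => m n.
  wlog lemn : m n / (m <= n)%N => [wl|leMm leMn].
    by case/orP: (leq_total m n) => le *; last rewrite bn_distC; apply: wl.
  rewrite bn_distC -rmorphB (le_lt_trans (bn_eval_le _)) //.
    exact: nneg_coefs_sqrt_polyB.
  have := ltM m n leMm lemn; rewrite ltr_pdivlMr ?ltr_wpDl //.
  apply: le_lt_trans; rewrite mulrC ler_wpM2l ?lerDl //.
  exact/nneg_coefs_horner1/nneg_coefs_sqrt_polyB.
have [y cvy] := bn_complete bn cauchy.
have le_u n : nu (u n) <= K.
  rewrite (le_trans (bn_eval_le (@nneg_coefs_sqrt_poly R n))) //.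
  by rewrite ler_piMr ?sqrt_poly1_le1.
have le_y : nu y <= K.
  apply/ler_addgt0Pr => e e0; have [M ltM] := cvy e e0.
  rewrite -[y](subrK (u M)) (le_trans (bn_triangle bn _ _)) // addrC lerD //.
  by rewrite bn_distC ltW // ltM.
have fix_y : y = c 2^-1 * (z + y * y).
  apply/eqP; rewrite -subr_eq0; apply/eqP/bn_eq_small => e e0.
  have d0 : 0 < e / (2 * (K + 1)) by rewrite divr_gt0 ?mulr_gt0 ?ltr_wpDl.
  set d := e / _ in d0; have [M ltM] := cvy d d0.
  have uS : u M.+1 = c 2^-1 * (z + u M * u M).
    rewrite /u /= rmorphM rmorphD rmorphXn /= expr2; congr (_ * (_ + _)).
      by rewrite /bn_eval horner_morphC.
    by rewrite /bn_eval horner_morphX.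
  (* y minus its image, compared with the iterate of index [M + 1] *)
  have -> : y - c 2^-1 * (z + y * y) = (y - u M.+1) +
      c 2^-1 * (u M * (u M - y) + (u M - y) * y).
        have -> : u M * (u M - y) + (u M - y) * y = (z + u M * u M) - (z + y * y).
      by rewrite mulrBr mulrBl addrA subrK [in RHS]opprD addrACA subrr add0r.
    by rewrite uS mulrBr addrA subrK.
  have le1 : nu (y - u M.+1) < d by rewrite bn_distC ltM.
  have le2 : nu (u M - y) < d by rewrite ltM.
  apply: le_lt_trans (bn_triangle bn _ _) _.
  rewrite (bn_scale bn) ger0_norm ?invr_ge0 //.
  have le3 := bn_triangle bn (u M * (u M - y)) ((u M - y) * y).
  have le4 := bn_mul bn (u M) (u M - y).
  have le5 := bn_mul bn (u M - y) y.
  have ge0 := bn_norm_ge0 (u M - y).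
  have le6 : nu (u M) * nu (u M - y) <= K * d.
    by rewrite ler_pM ?bn_norm_ge0 // ltW.
  have le7 : nu (u M - y) * nu y <= d * K by rewrite ler_pM ?bn_norm_ge0 // ltW.
  have ed : e = d * (2 * (K + 1)).
    by rewrite /d divfK // gt_eqF ?mulr_gt0 ?ltr_wpDl.
  rewrite ed; nra.
exists y; split=> //.
  have two_y : y + y = z + y * y.
    rewrite {1 2}fix_y -mulrDl -rmorphD -mulr2n -[_ *+ 2]mulr_natr mulVf ?pnatr_eq0 //.
    by rewrite rmorph1 mul1r.
  have -> : z = y + y - y * y by rewrite two_y addrK.
  by rewrite mulrBl mul1r mulrBr mulr1 -addrA !opprB opprD [- y + _]addrCA.
move=> e e0; have [M ltM] := cvy e e0.
exists (u M); first by exists (sqrt_poly R M).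
by rewrite bn_distC ltM.
Qed.

End BanachSqrt.

(** * Norm and positive cone of a C*-algebra *)

Section CStarNorm.
Variables (R : realType) (D : cstarAlgType R).
Implicit Types (x y : D) (r : R).

Lemma cnormZr r x : cnorm (r%:C *: x) = `|r| * cnorm x.
Proof. by rewrite cnormZ /= expr0n addr0 sqrtr_sqr. Qed.

Lemma starZr r x : star (r%:C *: x) = r%:C *: star x.
Proof. by rewrite starZ; congr (_ *: _); apply: conjc_real. Qed.

Lemma starN x : star (- x) = - star x.
Proof. by apply: (addIr (star x)); rewrite -starD !addNr star0. Qed.

Lemma starB x y : star (x - y) = star x - star y.
Proof. by rewrite starD starN. Qed.

Lemma star_sum (I : Type) (s : seq I) (F : I -> D) :
  star (\sum_(i <- s) F i) = \sum_(i <- s) star (F i).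
Proof. exact: (big_morph _ (@starD _ D) (star0 D)). Qed.

Definition cstar_scalar : R -> D := in_alg D \o real_complex R.
HB.instance Definition _ := GRing.RMorphism.on cstar_scalar.

Lemma cstar_scalarE r x : cstar_scalar r * x = r%:C *: x.
Proof. exact: mulr_algl. Qed.

Lemma cstar_banach : banach_norm cstar_scalar (@cnorm R D).
Proof.
split.
- by move=> r x; rewrite cstar_scalarE mulr_algr.
- exact: cnorm0_eq0.
- exact: cnormD.
- by move=> r x; rewrite cstar_scalarE cnormZr.
- exact: cnormM.
- exact: cnorm_complete.
Qed.

Lemma cnorm_ge0 x : 0 <= cnorm x.
Proof. exact: (bn_norm_ge0 cstar_banach). Qed.

Lemma cnorm0 : cnorm (0 : D) = 0.
Proof. exact: (bn_norm0 cstar_banach). Qed.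

Lemma cnormN x : cnorm (- x) = cnorm x.
Proof. exact: (bn_normN cstar_banach). Qed.

Lemma cnorm_starE x : cnorm (star x) = cnorm x.
Proof.
suff le y : cnorm y <= cnorm (star y) by apply/eqP; rewrite eq_le -{2}(starK x) !le.
have [->|y0] := eqVneq (cnorm y) 0; first exact: cnorm_ge0.
have := cnormM (star y) y; rewrite cnorm_star expr2 ler_pM2r //.
by rewrite lt_def y0 cnorm_ge0.
Qed.

Lemma cnorm1 : cnorm (1 : D) = 1.
Proof.
have := cnorm_star (1 : D); rewrite star1 mulr1 => /eqP.
rewrite expr2 -subr_eq0 -{1}[cnorm 1]mulr1 -mulrBr mulf_eq0.
case/orP=> [/eqP/cnorm0_eq0/eqP|].
  by rewrite oner_eq0.
by rewrite subr_eq0 => /eqP ->.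
Qed.

Definition selfadjoint x := star x = x.

Lemma selfadjoint_scalar r : selfadjoint (r%:C%:A).
Proof. by rewrite /selfadjoint starZr star1. Qed.

Lemma cnorm_sqr x : selfadjoint x -> cnorm (x * x) = cnorm x ^+ 2.
Proof. by move=> sx; rewrite -cnorm_star sx. Qed.

Lemma selfadjoint_sqr_eq0 x : selfadjoint x -> x * x = 0 -> x = 0.
Proof.
move=> sx x0; apply: cnorm0_eq0; apply/eqP.
by rewrite -sqrf_eq0 -cnorm_sqr // x0 cnorm0.
Qed.

Lemma selfadjoint_eval z (p : {poly R}) :
  selfadjoint z -> selfadjoint (bn_eval cstar_banach z p).
Proof.
move=> sz; rewrite /selfadjoint bn_evalE star_sum; apply: eq_bigr => i _.
rewrite cstar_scalarE starZr; congr (_ *: _).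
elim: (i : nat) => [|k IH]; first by rewrite expr0 star1.
by rewrite [in LHS]exprS starM IH sz -exprSr.
Qed.

Lemma comm_eval z w (p : {poly R}) :
  w * z = z * w -> w * bn_eval cstar_banach z p = bn_eval cstar_banach z p * w.
Proof.
move=> wz; rewrite bn_evalE mulr_sumr mulr_suml; apply: eq_bigr => i _.
rewrite mulrA -(bn_central cstar_banach) -!mulrA; congr (_ * _).
exact: commrX.
Qed.

Lemma cstar_sqrt1B z : selfadjoint z -> cnorm z <= 1 -> exists y : D,
  [/\ (1 - y) * (1 - y) = 1 - z, cnorm y <= 1, selfadjoint y &
      forall w, w * z = z * w -> w * y = y * w].
Proof.
move=> sz z1; have powz k : cnorm (z ^+ k) <= 1.
  elim: k => [|k IH]; first by rewrite cnorm1.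
  rewrite exprS (le_trans (cnormM _ _)) // mulr_ile1 ?cnorm_ge0 //.
have [y [sqy y1 appr]] := bn_sqrt cstar_banach powz; exists y; split=> //.
  apply: (bn_fixed_limit cstar_banach _ _ _ appr) => [a b|a|_ [p ->]].
  - exact: starB.
  - exact: cnorm_starE.
  - exact: selfadjoint_eval.
move=> w wz; apply/eqP; rewrite -subr_eq0.
apply/eqP/(bn_eq_small cstar_banach) => e e0.
have d0 : 0 < cnorm w + 1 by rewrite ltr_wpDl ?cnorm_ge0.
have /appr[_ [p ->]] : 0 < e / (2 * (cnorm w + 1)) by rewrite divr_gt0 ?mulr_gt0.
set d := y - _ => ltd.
have -> : w * y - y * w = w * d - d * w.
  by rewrite mulrBr mulrBl (comm_eval p wz) opprB addrA subrK.
rewrite (le_lt_trans (cnormD _ _)) // cnormN.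
have := cnormM w d; have := cnormM d w.
move: ltd; rewrite ltr_pdivlMr ?mulr_gt0 // => lt le1 le2.
have := cnorm_ge0 d; have := cnorm_ge0 w; nra.
Qed.

(** The condition says that the spectrum of [x] lies in the interval from [0]
    to [2 t].  In this form the positive elements visibly form a convex cone and
    have square roots. *)
Definition cpos x : Prop :=
  selfadjoint x /\ exists2 t : R, 0 <= t & cnorm (t%:C%:A - x) <= t.

Lemma cpos_sa x : cpos x -> selfadjoint x.
Proof. by case. Qed.

Lemma cposD x y : cpos x -> cpos y -> cpos (x + y).
Proof.
move=> [sx [t t0 tx]] [sy [s s0 sy']]; split.
  by rewrite /selfadjoint starD sx sy.
exists (t + s); first exact: addr_ge0.
rewrite rmorphD /= scalerDl opprD addrACA (le_trans (cnormD _ _)) //.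
exact: lerD.
Qed.

Lemma cpos0 : cpos 0.
Proof. by split; [exact: star0|exists 0; rewrite // scale0r subr0 cnorm0]. Qed.

Lemma cposZ r x : 0 <= r -> cpos x -> cpos (r%:C *: x).
Proof.
move=> r0 [sx [t t0 tx]]; split; first by rewrite /selfadjoint starZr sx.
exists (r * t); first exact: mulr_ge0.
by rewrite rmorphM /= -scalerA -scalerBr cnormZr ger0_norm // ler_wpM2l.
Qed.

Lemma cposMn x n : cpos x -> cpos (x *+ n).
Proof.
by move=> px; elim: n => [|n IH]; [exact: cpos0|rewrite mulrS; apply: cposD].
Qed.

Lemma cpos_sum (I : Type) (s : seq I) (P : pred I) (F : I -> D) :
  (forall i, P i -> cpos (F i)) -> cpos (\sum_(i <- s | P i) F i).
Proof. by move=> pF; apply: big_ind => //; [exact: cpos0|exact: cposD]. Qed.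

Lemma cpos_scalar r : 0 <= r -> cpos (r%:C%:A).
Proof.
move=> r0; split; first exact: selfadjoint_scalar.
by exists r => //; rewrite subrr cnorm0.
Qed.

Lemma cpos_normB x : selfadjoint x -> cpos ((cnorm x)%:C%:A - x).
Proof.
move=> sx; split; first by rewrite /selfadjoint starB selfadjoint_scalar sx.
by exists (cnorm x); rewrite ?cnorm_ge0 // subKr.
Qed.

(** Rescale [x] to [1 - z] with [cnorm z <= 1] and use the series. *)
Lemma cpos_sqrt x : cpos x -> exists k : D,
  [/\ cpos k, k * k = x & forall w, w * x = x * w -> w * k = k * w].
Proof.
move=> [sx [t t0 tx]]; have [t00|tn0] := eqVneq t 0.
  move: tx; rewrite t00 scale0r sub0r cnormN => x0.
  have {x0}-> : x = 0.
    by apply: cnorm0_eq0; apply/eqP; rewrite eq_le x0 cnorm_ge0.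
  exists 0; split=> [||w _]; rewrite ?mulr0 ?mul0r //; exact: cpos0.
have tgt0 : 0 < t by rewrite lt_def tn0.
pose z : D := 1 - (t^-1)%:C *: x.
have sz : selfadjoint z by rewrite /selfadjoint starB star1 starZr sx.
have zE : z = (t^-1)%:C *: (t%:C%:A - x).
  by rewrite scalerBr scalerA -rmorphM mulVf // scale1r.
have z1 : cnorm z <= 1.
  by rewrite zE cnormZr gtr0_norm ?invr_gt0 // mulrC ler_pdivrMr // mul1r.
have [y [sqy y1 sy commy]] := cstar_sqrt1B sz z1.
pose q := (Num.sqrt t)%:C; have qq : q * q = t%:C.
  by rewrite -rmorphM -expr2 sqr_sqrtr.
exists (q *: (1 - y)); split.
- split; first by rewrite /selfadjoint starZr starB star1 sy.
  exists (Num.sqrt t); first exact: sqrtr_ge0.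
  rewrite -scalerBr subKr cnormZr ger0_norm ?sqrtr_ge0 //.
  by rewrite ler_piMr ?sqrtr_ge0.
- rewrite -scalerAl -scalerAr scalerA qq sqy /z subKr.
  by rewrite scalerA -rmorphM mulfV // scale1r.
move=> w wx; rewrite -scalerAl -scalerAr mulrBl mulrBr mul1r mulr1 commy //.
by rewrite mulrBl mulrBr mul1r mulr1 -scalerAl -scalerAr wx.
Qed.

(** The element [u = k + i l] satisfies [star u * u = t], and [k] is its real
    part. *)
Lemma cnorm_sqr_le k l (t : R) : 0 <= t -> selfadjoint k -> selfadjoint l ->
  k * l = l * k -> k * k + l * l = t%:C%:A -> cnorm k ^+ 2 <= t.
Proof.
move=> t0 sk sl kl klt; pose u := k + 'i *: l.
have su : star u = k - 'i *: l.
  by rewrite starD starZ sk sl conjCi scaleNr.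
have nu : cnorm u ^+ 2 = t.
  rewrite -cnorm_star su; have -> : (k - 'i *: l) * u = t%:C%:A; last first.
    by rewrite cnormZr cnorm1 mulr1 ger0_norm.
  rewrite mulrBl !mulrDr -!scalerAl -!scalerAr kl opprD addrA addrK.
  by rewrite scalerA -[_ * 'i]expr2 sqrCi scaleN1r opprK.
have kE : u + star u = 2%:C *: k.
  rewrite su addrACA subrr addr0 -mulr2n -scaler_nat; congr (_ *: _).
  by rewrite rmorph_nat.
have : cnorm (2%:C *: k) <= cnorm u + cnorm u.
  by rewrite -kE -[X in _ <= _ + X]cnorm_starE cnormD.
rewrite cnormZr ger0_norm // => le2.
by rewrite -nu ler_sqr ?nnegrE ?cnorm_ge0 //; lra.
Qed.

(** With [l] the square root of [cnorm (k * k) - k * k], the previous bound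
    applied to the commuting pair [l, k] is what the cone requires. *)
Lemma cpos_sqr k : selfadjoint k -> cpos (k * k).
Proof.
move=> sk; have skk : selfadjoint (k * k) by rewrite /selfadjoint starM sk.
have := cpos_normB skk; set x := _ - _ => px.
have [l [/cpos_sa sl lx comml]] := cpos_sqrt px.
split=> //; exists (cnorm (k * k)); first exact: cnorm_ge0.
rewrite -/x -lx cnorm_sqr //; apply: (@cnorm_sqr_le l k) => //.
- exact: cnorm_ge0.
- apply/esym/comml; rewrite /x mulrBl mulrBr mulrA; congr (_ - _).
  by rewrite mulr_algl mulr_algr.
- by rewrite lx subrK.
Qed.

Lemma cpos_norm_le x r : 0 <= r -> cpos x -> cpos (r%:C%:A - x) -> cnorm x <= r.
Proof.
move=> r0 px pr; have [k [/cpos_sa sk kx commk]] := cpos_sqrt px.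
have [l [/cpos_sa sl lr comml]] := cpos_sqrt pr.
rewrite -kx cnorm_sqr //; apply: (@cnorm_sqr_le k l) => //; last first.
  by rewrite kx lr addrC subrK.
apply: comml; rewrite mulrBl mulrBr mulr_algl mulr_algr; congr (_ - _).
by apply/esym/commk.
Qed.

Lemma cpos_cnorm_le x y : cpos x -> cpos (y - x) -> cnorm x <= cnorm y.
Proof.
move=> px pyx; apply: cpos_norm_le => //; first exact: cnorm_ge0.
have sy : selfadjoint y.
  by have := cpos_sa (cposD px pyx); rewrite addrC subrK.
by rewrite -(subrK y (_%:C%:A)) -addrA; apply: cposD => //; apply: cpos_normB.
Qed.

End CStarNorm.

(** * Positivity of [star x * x] *)

Section CStarPos.
Variables (R : realType) (D : cstarAlgType R).
Implicit Types (x y : D) (r : R).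

Lemma selfadjointX x n : selfadjoint x -> selfadjoint (x ^+ n).
Proof.
move=> sx; elim: n => [|n IH]; first exact: star1.
by rewrite /selfadjoint [in LHS]exprS starM IH sx -exprSr.
Qed.

Lemma cpos_expr_double x n : selfadjoint x -> cpos (x ^+ n.*2).
Proof. by move=> sx; rewrite -addnn exprD; apply/cpos_sqr/selfadjointX. Qed.

(** Twice the sum of the squares of the real and imaginary parts of [y]. *)
Lemma cpos_starMD y : cpos (star y * y + y * star y).
Proof.
have -> : star y * y + y * star y = (2^-1)%:C *:
    ((y + star y) * (y + star y) + ('i *: (y - star y)) * ('i *: (y - star y))).
  rewrite -scalerAl -scalerAr scalerA -['i * 'i]expr2 sqrCi scaleN1r.
  rewrite !mulrDl !mulrDr !mulrN !mulNr opprK !opprD !opprK.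
  set a := y * y; set b := y * star y; set c := star y * y; set d := star y * _.
  have -> : a + b + (c + d) + (- a + b + (c - d)) = 2%:C *: (c + b).
    rewrite addrACA [a + b + _]addrACA [c + d + _]addrACA !subrr add0r addr0.
    by rewrite addrC -!mulr2n -mulrnDl -scaler_nat rmorph_nat.
  by rewrite scalerA -rmorphM mulVf ?pnatr_eq0 // scale1r.
apply: cposZ; first by rewrite invr_ge0 ler0n.
apply: cposD; apply: cpos_sqr; first by rewrite /selfadjoint starD starK addrC.
by rewrite /selfadjoint starZ starB starK conjCi scaleNr -scalerN opprB.
Qed.

(** The elements [star y * y] and [c = y * star y] have the same nonzero
    spectrum, the first being negative, the second positive by [cpos_starMD].
    The following replaces the spectral argument: for small [e > 0],
    [1 - e c] is a contraction, while moving [y] across its powers turns them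
    into powers of [1 + e p ^ 2], which dominate [n e p ^ 2].  Boundedness in
    [n] forces [p] to vanish. *)
Lemma star_mul_neg_sqr_eq0 y p :
  selfadjoint p -> star y * y = - (p * p) -> y = 0.
Proof.
move=> sp yy; pose c := y * star y.
have pc : cpos c.
  have -> : c = star y * y + y * star y + p * p by rewrite yy addrAC addNr add0r.
  by apply: cposD; [exact: cpos_starMD|exact: cpos_sqr].
pose e := (cnorm c + 1)^-1.
have c1 : 0 < cnorm c + 1 by rewrite ltr_wpDl ?cnorm_ge0.
have e0 : 0 < e by rewrite invr_gt0.
have ec1 : e * cnorm c <= 1 by rewrite mulrC ler_pdivrMr // mul1r lerDl.
pose w := 1 - e%:C *: c; pose q := e%:C *: (p * p).
have w1 : cnorm w <= 1.
  apply: cpos_norm_le => //.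
    have -> : w = e%:C *: ((cnorm c)%:C%:A - c) + (1 - e * cnorm c)%:C%:A.
      rewrite scalerBr scalerA -rmorphM rmorphB scalerBl scale1r /=.
      by rewrite [RHS]addrC addrA subrK.
    apply: cposD; last by apply: cpos_scalar; rewrite subr_ge0.
    by apply: cposZ; [exact: ltW|apply/cpos_normB/cpos_sa].
  by rewrite scale1r subKr; apply: cposZ => //; exact: ltW.
have yw n : star y * w ^+ n = (1 + q) ^+ n * star y.
  elim: n => [|n IH]; first by rewrite !expr0 mulr1 mul1r.
  rewrite exprSr mulrA IH exprSr -!mulrA; congr (_ * _).
  rewrite mulrBr mulr1 mulrDl mul1r -scalerAr -scalerAl /c mulrA yy.
  by rewrite mulNr scalerN opprK.
have wn1 n : cnorm (w ^+ n) <= 1.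
  elim: n => [|n IH]; first by rewrite cnorm1.
  by rewrite exprS (le_trans (cnormM _ _)) // mulr_ile1 ?cnorm_ge0.
have pow n : (1 + q) ^+ n * p ^+ 4 = star y * w ^+ n * (c * y).
  rewrite yw /c -!mulrA; congr (_ * _).
  by rewrite yy !mulrN mulrA yy mulNr opprK !exprS expr0 mulr1 !mulrA.
have qE i : q ^+ i * p ^+ 4 = (e ^+ i)%:C *: p ^+ (i.+2).*2.
  rewrite exprZn -rmorphXn -scalerAl -expr2 -exprM -exprD; congr (_ *: p ^+ _).
  by rewrite doubleS doubleS -mul2n addnC.
pose K := cnorm (star y) * (cnorm c * cnorm y).
(* in the binomial expansion of the power of [1 + q], every term times
   [p ^ 4] is a nonnegative multiple of a
   square; only the term of index 1 is kept *)
have bound n : n%:R * (e * cnorm (p ^+ 6)) <= K.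
  have pos : cpos ((1 + q) ^+ n * p ^+ 4 - (q * p ^+ 4) *+ n).
    rewrite [1 + q]addrC exprD1n; case: n => [|n].
      by rewrite mulr0n subr0 big_ord1 expr0 bin0 mulr1n mul1r; apply: (cpos_expr_double 2).
    rewrite mulr_suml (bigD1 (inord 1)) //= inordK // expr1 bin1 mulrnAl addrC addrK.
    apply: cpos_sum => i _; rewrite mulrnAl qE; apply/cposMn/cposZ.
      by rewrite exprn_ge0 // ltW.
    exact: cpos_expr_double.
  have : cnorm ((q * p ^+ 4) *+ n) <= K.
    apply: le_trans (cpos_cnorm_le _ pos) _.
      apply: cposMn; rewrite -[q]expr1 qE; apply: cposZ; first by rewrite expr1 ltW.
      exact: cpos_expr_double.
    rewrite pow (le_trans (cnormM _ _)) // ler_pM ?cnorm_ge0 ?cnormM //.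
    by rewrite (le_trans (cnormM _ _)) // ler_piMr ?cnorm_ge0.
  rewrite -[q]expr1 qE expr1 -scaler_nat scalerA.
  have -> : (n%:R * e%:C : R[i]) = (n%:R * e)%:C by rewrite rmorphM rmorph_nat.
  by rewrite cnormZr ger0_norm ?mulrA // mulr_ge0 // ltW.
have p60 : cnorm (p ^+ 6) = 0.
  apply/eqP/negPn/negP => n0.
  have p6 : 0 < e * cnorm (p ^+ 6) by rewrite mulr_gt0 // lt_def n0 cnorm_ge0.
  have K0 : 0 <= K by rewrite !mulr_ge0 ?cnorm_ge0.
  have := archi_boundP (divr_ge0 K0 (ltW p6)); rewrite ltr_pdivrMr //.
  by rewrite ltNge bound.
(* square roots can be extracted from the vanishing of [p ^ 8] *)
have halve n : p ^+ n * p ^+ n = 0 -> p ^+ n = 0.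
  by apply/selfadjoint_sqr_eq0/selfadjointX.
have p0 : p = 0.
  move/cnorm0_eq0: p60 => p60.
  apply: (halve 1%N); rewrite -exprD; apply: (halve 2%N); rewrite -exprD.
  by apply: (halve 4%N); rewrite -exprD -[(4 + 4)%N]/(6 + 2)%N exprD p60 mul0r.
apply: cnorm0_eq0; apply/eqP; rewrite -sqrf_eq0 -cnorm_star yy p0 mulr0 oppr0.
by rewrite cnorm0.
Qed.

(** Kaplansky's argument.  With [a = star x * x] and [b] its absolute value,
    [g = b - a] is twice the negative part of [a], and [y = x g] satisfies
    [star y * y = g a g = - b g ^ 2], the opposite of a square.  Hence [y = 0],
    which forces [g = 0], that is [a = b]. *)
Theorem cpos_star_mul x : cpos (star x * x).
Proof.
set a := star x * x; have sa : selfadjoint a by rewrite /selfadjoint starM starK.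
have [b [pb bb commb]] := cpos_sqrt (cpos_sqr sa).
have [r [pr rr commr]] := cpos_sqrt pb.
have sb := cpos_sa pb; have sr := cpos_sa pr.
have ab : a * b = b * a by apply: commb; rewrite mulrA.
pose g := b - a; have sg : selfadjoint g by rewrite /selfadjoint starB sb sa.
have gg : g * g = b * g *+ 2.
  rewrite /g mulrBl !mulrBr ab -bb mulr2n opprB.
  by rewrite addrC.
have bg : b * g = g * b by rewrite /g mulrBl mulrBr ab.
have rg : r * g = g * r by rewrite -commr.
have ag : a * g = - (b * g) by rewrite /g !mulrBr ab bb opprB.
have y0 : x * g = 0.
  apply: (@star_mul_neg_sqr_eq0 _ (r * g)).
    by rewrite /selfadjoint starM sr sg -rg.
  rewrite starM sg -[g * _ * _]mulrA [star x * _]mulrA -/a ag mulrN; congr (- _).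
  by rewrite {1}rg -rr -!mulrA.
have bg0 : b * g = 0.
  suff -> : b * g = - (star x * (x * g)) by rewrite y0 mulr0 oppr0.
  by rewrite mulrA -/a ag opprK.
have g0 : g = 0 by apply: selfadjoint_sqr_eq0 => //; rewrite gg bg0 mul0rn.
suff -> : a = b by [].
by apply/esym/eqP; rewrite -subr_eq0 -/g g0.
Qed.

End CStarPos.

(** * Gram matrices are squares in the matrix algebra *)

Section CStarOrder.
Variables (R : realType) (D : cstarAlgType R).
Implicit Types (x y : D) (r : R).

Definition cle x y := cpos (y - x).

Lemma cle_refl x : cle x x.
Proof. by rewrite /cle subrr; apply: cpos0. Qed.

Lemma cle_trans y x z : cle x y -> cle y z -> cle x z.
Proof. by move=> xy yz; rewrite /cle -(subrK y z) -addrA; apply: cposD. Qed.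

Lemma cle_sum (I : Type) (s : seq I) (F G : I -> D) :
  (forall i, cle (F i) (G i)) -> cle (\sum_(i <- s) F i) (\sum_(i <- s) G i).
Proof. by move=> le; rewrite /cle -sumrB; apply: cpos_sum => i _; apply: le. Qed.

Lemma cleZ r x y : 0 <= r -> cle x y -> cle (r%:C *: x) (r%:C *: y).
Proof. by move=> r0 xy; rewrite /cle -scalerBr; apply: cposZ. Qed.

Lemma cleZl r s x : r <= s -> cpos x -> cle (r%:C *: x) (s%:C *: x).
Proof.
by move=> rs px; rewrite /cle -scalerBl -rmorphB; apply: cposZ; rewrite ?subr_ge0.
Qed.

(** Write [y = k * k] and recognize [star (k * x) * (k * x)]. *)
Lemma cpos_conj x y : cpos y -> cpos (star x * y * x).
Proof.
move=> /cpos_sqrt[k [/cpos_sa sk <- _]].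
by rewrite -{1}sk mulrA -starM -mulrA; apply: cpos_star_mul.
Qed.

Lemma cle_star_mulM w x :
  cle (star (w * x) * (w * x)) ((cnorm w ^+ 2)%:C *: (star x * x)).
Proof.
rewrite /cle starM.
have -> : (cnorm w ^+ 2)%:C *: (star x * x) - star x * star w * (w * x) =
    star x * ((cnorm (star w * w))%:C%:A - star w * w) * x.
  by rewrite mulrBr mulrBl mulr_algr -scalerAl cnorm_star !mulrA.
by apply/cpos_conj/cpos_normB; rewrite /selfadjoint starM starK.
Qed.

(** Cauchy-Schwarz: the difference is half of the double sum of the
    [star (x i - x j) * (x i - x j)]. *)
Lemma cle_star_mul_sum p (x : 'I_p -> D) :
  cle (star (\sum_i x i) * \sum_i x i) (p%:R%:C *: \sum_i star (x i) * x i).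
Proof.
rewrite /cle; set S := \sum_i x i; set Q := \sum_i _.
have -> : p%:R%:C *: Q - star S * S = (2^-1)%:C *:
    \sum_i \sum_j star (x i - x j) * (x i - x j).
  have -> : \sum_i \sum_j star (x i - x j) * (x i - x j) =
      2%:R%:C *: (p%:R%:C *: Q - star S * S).
    have E i : \sum_j star (x i - x j) * (x i - x j) =
        star (x i) * x i *+ p - star (x i) * S + (Q - star S * x i).
      rewrite /Q /S star_sum mulr_sumr mulr_suml -!sumrB -[X in _ *+ X]card_ord.
      rewrite -sumr_const -sumrB -big_split; apply: eq_bigr => j _ /=.
      by rewrite starB mulrBl !mulrBr opprB.
    under eq_bigr => i _ do rewrite E.
    rewrite !big_split /= !sumrN -mulr_sumr -mulr_suml -star_sum -/S.
    rewrite sumr_const card_ord sumrMnl -/Q -mulr2n -scaler_nat.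
    by rewrite !(rmorph_nat (real_complex R)) [p%:R *: _]scaler_nat.
  by rewrite scalerA -rmorphM mulVf ?pnatr_eq0 // scale1r.
apply: cposZ; first by rewrite invr_ge0 ler0n.
by do 2!apply: cpos_sum => ? _; apply: cpos_star_mul.
Qed.

End CStarOrder.

Section MatrixStar.
Variables (R : realType) (D : cstarAlgType R).

Lemma mx_starE m n (M : 'M[D]_(m, n)) i j : mx_star M i j = star (M j i).
Proof. by rewrite !mxE. Qed.

Lemma mx_starK m n (M : 'M[D]_(m, n)) : mx_star (mx_star M) = M.
Proof. by apply/matrixP => i j; rewrite !mx_starE starK. Qed.

Lemma mx_starB m n (M M' : 'M[D]_(m, n)) :
  mx_star (M - M') = mx_star M - mx_star M'.
Proof. by apply/matrixP => i j; rewrite !mxE starB. Qed.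

Lemma mx_starM m n p (M : 'M[D]_(m, n)) (M' : 'M[D]_(n, p)) :
  mx_star (M *m M') = mx_star M' *m mx_star M.
Proof.
apply/matrixP => i j; rewrite !mxE star_sum; apply: eq_bigr => k _.
by rewrite !mxE starM.
Qed.

Lemma mx_starZ m n r (M : 'M[D]_(m, n)) :
  mx_star (cstar_scalar D r *: M) = cstar_scalar D r *: mx_star M.
Proof. by apply/matrixP => i j; rewrite !mxE !cstar_scalarE starZr. Qed.

Lemma mulmx_cscaler m n p r (M : 'M[D]_(m, n)) (M' : 'M[D]_(n, p)) :
  M *m (cstar_scalar D r *: M') = cstar_scalar D r *: (M *m M').
Proof.
apply/matrixP => i j; rewrite !mxE mulr_sumr; apply: eq_bigr => k _.
by rewrite !mxE mulrA -(bn_central (cstar_banach D)) mulrA.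
Qed.

Definition mx_sqnorm n (u : 'cV[D]_n) : D := (mx_star u *m u) 0 0.

Lemma mx_sqnormE n (u : 'cV[D]_n) :
  mx_sqnorm u = \sum_i star (u i 0) * u i 0.
Proof. by rewrite /mx_sqnorm mxE; apply: eq_bigr => i _; rewrite mx_starE. Qed.

Lemma cpos_mx_sqnorm n (u : 'cV[D]_n) : cpos (mx_sqnorm u).
Proof. by rewrite mx_sqnormE; apply: cpos_sum => i _; apply: cpos_star_mul. Qed.

(** Cauchy-Schwarz on each entry of the product, then [cle_star_mulM] on each
    entry of [W]. *)
Lemma mx_star_bounded p n (W : 'M[D]_(p, n)) : exists2 c : R, 0 < c &
  forall u : 'cV_p, cle (mx_sqnorm (mx_star W *m u)) (c%:C *: mx_sqnorm u).
Proof.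
pose M := \sum_j \sum_i cnorm (W j i) ^+ 2.
have M0 : 0 <= M.
  by rewrite sumr_ge0 // => j _; rewrite sumr_ge0 // => i _; rewrite sqr_ge0.
have leM j i : cnorm (W j i) ^+ 2 <= M.
  rewrite /M (bigD1 j) //= (bigD1 i) //= -addrA lerDl addr_ge0 //.
    by rewrite sumr_ge0 // => k _; rewrite sqr_ge0.
  by rewrite sumr_ge0 // => l _; rewrite sumr_ge0 // => k _; rewrite sqr_ge0.
exists (n%:R * (p%:R * M) + 1) => [|u].
  by rewrite ltr_wpDl // !mulr_ge0.
have le1 i : cle (star ((mx_star W *m u) i 0) * (mx_star W *m u) i 0)
    ((p%:R * M)%:C *: mx_sqnorm u).
  rewrite mxE; apply: cle_trans (cle_star_mul_sum _) _.
  rewrite rmorphM -scalerA.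
  apply: cleZ => //; rewrite mx_sqnormE scaler_sumr; apply: cle_sum => j.
  apply: cle_trans (cle_star_mulM _ _) _.
  by apply: cleZl; rewrite ?mx_starE ?cnorm_starE //; exact: cpos_star_mul.
rewrite [X in cle X _]mx_sqnormE; apply: cle_trans (cle_sum _ le1) _.
rewrite sumr_const card_ord -scaler_nat scalerA.
rewrite -(rmorph_nat (real_complex R)) -rmorphM.
by apply: cleZl; [rewrite lerDl|exact: cpos_mx_sqnorm].
Qed.

Variable n : nat.
Notation mxD := 'M[D]_n.+1.

Definition mx_norm1 (M : mxD) : R := \sum_i \sum_j cnorm (M i j).

Definition mx_cscalar : R -> mxD := (@scalar_mx D n.+1) \o cstar_scalar D.
HB.instance Definition _ := GRing.RMorphism.on mx_cscalar.

Lemma mx_cscalarE r (M : mxD) : mx_cscalar r * M = cstar_scalar D r *: M.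
Proof. exact: mul_scalar_mx. Qed.

Lemma mx_norm1_ge (M : mxD) i j : cnorm (M i j) <= mx_norm1 M.
Proof.
rewrite /mx_norm1 (bigD1 i) //= (bigD1 j) //= -addrA lerDl addr_ge0 //.
  by rewrite sumr_ge0 // => k _; rewrite cnorm_ge0.
by rewrite sumr_ge0 // => l _; rewrite sumr_ge0 // => k _; rewrite cnorm_ge0.
Qed.

Lemma mx_norm1_star (M : mxD) : mx_norm1 (mx_star M) = mx_norm1 M.
Proof.
rewrite /mx_norm1 exchange_big; apply: eq_bigr => i _; apply: eq_bigr => j _.
by rewrite mx_starE cnorm_starE.
Qed.

Lemma mx_norm1_le (M : mxD) (e : R) :
  (forall i j, cnorm (M i j) <= e) -> mx_norm1 M <= n.+1%:R * (n.+1%:R * e).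
Proof.
move=> le; rewrite mulr_natl -[X in _ *+ X]card_ord -sumr_const.
apply: ler_sum => i _; rewrite mulr_natl -[X in _ *+ X]card_ord.
by rewrite -sumr_const; apply: ler_sum => j _.
Qed.

Lemma mx_banach : banach_norm mx_cscalar mx_norm1.
Proof.
split.
- move=> r M; rewrite mx_cscalarE -[RHS]/(M *m (cstar_scalar D r)%:M).
  by rewrite -scalemx1 mulmx_cscaler mulmx1.
- move=> M M0; apply/matrixP => i j; rewrite mxE; apply: cnorm0_eq0.
  by apply/eqP; rewrite eq_le cnorm_ge0 -M0 mx_norm1_ge.
- move=> M M'; rewrite /mx_norm1 -big_split /=; apply: ler_sum => i _.
  by rewrite -big_split /=; apply: ler_sum => j _; rewrite mxE cnormD.
- move=> r M; rewrite mx_cscalarE /mx_norm1 mulr_sumr; apply: eq_bigr => i _.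
  by rewrite mulr_sumr; apply: eq_bigr => j _; rewrite mxE cstar_scalarE cnormZr.
- move=> M M'; rewrite {1}/mx_norm1 [X in _ <= X * _]/mx_norm1 mulr_suml.
  apply: ler_sum => i _.
  apply: (@le_trans _ _ (\sum_j \sum_k cnorm (M i k) * cnorm (M' k j))).
    apply: ler_sum => j _; rewrite mxE.
    rewrite (le_trans (bn_norm_sum (cstar_banach D) _ _)) //.
    by apply: ler_sum => k _; apply: cnormM.
  rewrite exchange_big mulr_suml; apply: ler_sum => k _ /=.
  rewrite -mulr_sumr ler_wpM2l ?cnorm_ge0 // /mx_norm1.
  rewrite [X in _ <= X](bigD1 k) //= lerDl.
  by rewrite sumr_ge0 // => l _; rewrite sumr_ge0 // => j _; rewrite cnorm_ge0.
move=> u cauchy.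
have limij (ij : 'I_n.+1 * 'I_n.+1) : exists l : D, forall e : R, 0 < e ->
    exists K : nat, forall m, (K <= m)%N -> cnorm (u m ij.1 ij.2 - l) < e.
  apply: (cnorm_complete (fun m => u m ij.1 ij.2)) => e /cauchy[K ltK].
  exists K => p m leKp leKm; apply: le_lt_trans (ltK p m leKp leKm).
  by have := mx_norm1_ge (u p - u m) ij.1 ij.2; rewrite !mxE.
have [l liml] := choice limij.
exists (\matrix_(i, j) l (i, j)) => e e0.
pose d := e / (n.+1%:R * n.+1%:R + 1).
have N0 : 0 < (n.+1%:R * n.+1%:R + 1 : R) by rewrite ltr_wpDl ?mulr_ge0.
have d0 : 0 < d by rewrite divr_gt0.
have [K ltK] := choice (fun ij => liml ij d d0).
exists (\max_ij K ij) => m leKm.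
apply: (@le_lt_trans _ _ (n.+1%:R * (n.+1%:R * d))).
  apply: mx_norm1_le => i j; rewrite !mxE ltW // (ltK (i, j)) //.
  by apply: leq_trans leKm; apply: leq_bigmax.
by rewrite mulrA /d mulrA ltr_pdivrMr // mulrC ltr_pM2l // ltrDl.
Qed.

End MatrixStar.

Section MatrixGram.
Variables (R : realType) (D : cstarAlgType R).

Lemma mx_star_eval n (z : 'M[D]_n.+1) (p : {poly R}) :
  mx_star z = z ->
  mx_star (bn_eval (mx_banach D n) z p) = bn_eval (mx_banach D n) z p.
Proof.
move=> sz; rewrite bn_evalE.
have -> : mx_star (\sum_(i < size p) mx_cscalar D n p`_i * z ^+ i) =
    \sum_(i < size p) mx_star (mx_cscalar D n p`_i * z ^+ i).
  apply: (big_morph (@mx_star _ D _ _)) => [x y|];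
  by apply/matrixP => i j; rewrite !mxE ?starD ?star0.
apply: eq_bigr => i _; rewrite mx_cscalarE mx_starZ; congr (_ *: _).
elim: (i : nat) => [|k IH].
  by apply/matrixP => a b; rewrite !mxE eq_sym; case: eqP; rewrite ?star1 ?star0.
by rewrite [in LHS]exprS -mulmxE mx_starM IH sz mulmxE -exprSr.
Qed.

(** Rows in excess can be absorbed: the square root of [star W * W] is a square
    factor.  The order on [D] shows that [z = 1 - star W * W / c] contracts the
    [D]-valued square norm of columns, hence so do its powers; applied to the
    columns of the identity this bounds all entries. *)
Theorem mx_gram_pos p n (W : 'M[D]_(p, n)) : mx_is_pos (mx_star W *m W).
Proof.
case: n W => [|n] W; first by exists 0; rewrite [LHS]thinmx0 [RHS]thinmx0.
have [c c0 lec] := mx_star_bounded W; pose A := mx_star W *m W.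
pose s := cstar_scalar D; pose z : 'M[D]_n.+1 := 1 - s c^-1 *: A.
have sA : mx_star A = A by rewrite mx_starM mx_starK.
have s1 : mx_star (1 : 'M[D]_n.+1) = 1.
  by apply/matrixP => a b; rewrite !mxE eq_sym; case: eqP; rewrite ?star1 ?star0.
have sz : mx_star z = z by rewrite mx_starB s1 mx_starZ sA.
have contr (u : 'cV_n.+1) : cle (mx_sqnorm (z *m u)) (mx_sqnorm u).
  pose v := W *m u; pose w := mx_star W *m v.
  have zu : z *m u = u - s c^-1 *: w.
    by rewrite /z mulmxBl mul1mx -scalemxAl -mulmxA.
  have vu : mx_star w *m u = mx_star v *m v.
    by rewrite /w mx_starM mx_starK -mulmxA.
  have uv : mx_star u *m w = mx_star v *m v.
    by rewrite -[LHS]mx_starK mx_starM mx_starK vu mx_starM mx_starK.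
  have E : mx_star (z *m u) *m (z *m u) = mx_star u *m u - s c^-1 *:
      (mx_star v *m v + (mx_star v *m v - s c^-1 *: (mx_star w *m w))).
    rewrite zu mx_starB mx_starZ mulmxBl !mulmxBr !mulmx_cscaler -!scalemxAl.
    by rewrite uv vu -scalerBr -addrA -opprD -scalerDr.
  have -> : mx_sqnorm (z *m u) = mx_sqnorm u - (c^-1)%:C *:
      (mx_sqnorm v + (mx_sqnorm v - (c^-1)%:C *: mx_sqnorm w)).
    rewrite {1}/mx_sqnorm E /mx_sqnorm.
    move: (mx_star u *m u) (mx_star v *m v) (mx_star w *m w) => Mu Mv Mw.
    by rewrite !mxE !cstar_scalarE.
  rewrite /cle subKr; apply: cposZ; first by rewrite invr_ge0 ltW.
  apply: cposD; first exact: cpos_mx_sqnorm.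
  rewrite -[X in X - _]scale1r -(rmorph1 (real_complex R)) -(mulVf (lt0r_neq0 c0)).
  rewrite rmorphM -scalerA; apply: cleZ; first by rewrite invr_ge0 ltW.
  exact: lec.
have contrX k (u : 'cV_n.+1) : cle (mx_sqnorm (z ^+ k *m u)) (mx_sqnorm u).
  elim: k => [|k IH]; first by rewrite expr0 mul1mx; apply: cle_refl.
  by rewrite exprS -mulmxE -mulmxA; apply: cle_trans IH.
have powz k : mx_norm1 (z ^+ k) <= n.+1%:R * (n.+1%:R * 1).
  apply: mx_norm1_le => i j.
  pose u : 'cV[D]_n.+1 := delta_mx j 0; pose v := z ^+ k *m u.
  have vi i' : v i' 0 = (z ^+ k) i' j.
    rewrite /v mxE (bigD1 j) //= big1 ?addr0 => [|l lj].
      by rewrite mxE !eqxx mulr1.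
    by rewrite mxE (negPf lj) mulr0.
  have u1 : mx_sqnorm u = 1.
    rewrite mx_sqnormE (bigD1 j) //= big1 ?addr0 => [|l lj].
      by rewrite mxE !eqxx star1 mulr1.
    by rewrite mxE (negPf lj) mulr0.
  have le1 : cnorm (star (v i 0) * v i 0) <= 1.
    rewrite -(cnorm1 D) -u1; apply: cpos_cnorm_le; first exact: cpos_star_mul.
    apply: cle_trans (contrX k u).
    rewrite /cle mx_sqnormE (bigD1 i) //= [X in X - _]addrC addrK.
    by apply: cpos_sum => l _; apply: cpos_star_mul.
  by rewrite -vi -(@ler_sqr R) ?nnegrE ?cnorm_ge0 // -cnorm_star expr1n.
have [y [sqy _ appr]] := bn_sqrt (mx_banach D n) powz.
have sy : mx_star y = y.
  apply: (bn_fixed_limit (mx_banach D n) _ _ _ appr) => [a b|a|_ [q ->]].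
  - exact: mx_starB.
  - exact: mx_norm1_star.
  - exact: mx_star_eval.
exists (s (Num.sqrt c) *: (1 - y)).
rewrite mx_starZ mx_starB s1 sy -scalemxAl mulmx_cscaler scalerA -rmorphM -expr2.
rewrite sqr_sqrtr ?ltW // mulmxE sqy /z subKr scalerA -rmorphM mulfV ?gt_eqF //.
by rewrite rmorph1 scale1r.
Qed.

End MatrixGram.

(** * A model of the boolean power and of its independent copies *)

Section BooleanModel.
Variables (R : realType) (B D : cstarAlgType R) (iota : {lrmorphism B -> D}).
Variables (mu : ncpoly B -> D) (mu_bimod : bimodule_map iota mu) (mu1 : mu 1 = 1).
Variable (t : R).

(** Holds for the maps [g |-> <1, g u>] that represent the vectors [u]. *)
Definition left_linear (w : ncpoly B -> D) :=
  {morph w : g h / g + h} /\ (forall b g, w (fa_const b * g) = iota b * w g).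

Lemma left_linear_mu : left_linear mu.
Proof.
case: mu_bimod => lin bi; split=> [g h|b g].
  by have := lin 1 g h; rewrite !scale1r.
by rewrite -[_ * g]mulr1 -[1]/(fa_const 1) bi rmorph1 mulr1.
Qed.

Lemma mu_constr g b : mu (g * fa_const b) = mu g * iota b.
Proof.
by case: mu_bimod => _ bi; rewrite -[g]mul1r -[1]/(fa_const 1) bi mul1r rmorph1 mul1r.
Qed.

Lemma left_linear0 w : left_linear w -> w 0 = 0.
Proof. by move=> [wD _]; apply: (addIr (w 0)); rewrite -wD !add0r. Qed.

Lemma left_linear_const w b : left_linear w -> w (fa_const b) = iota b * w 1.
Proof. by move=> [_ wM]; rewrite -wM mulr1. Qed.

Notation X := (fa_var tt : ncpoly B).

(** The operator [X (1 - (1 - t) P)], where [P] is the projection on the vacuum: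
    the vector represented by [w] has vacuum coefficient [w 1], and [X] applied
    to the vacuum is represented by [g |-> mu (g * X)]. *)
Definition boolean_shift (w : ncpoly B -> D) (g : ncpoly B) : D :=
  w (g * X) - (1 - t)%:C *: (mu (g * X) * w 1).

Lemma left_linear_boolean_shift w : left_linear w -> left_linear (boolean_shift w).
Proof.
move=> [wD wM]; have [muD muM] := left_linear_mu; split=> [g h|b g].
  by rewrite /boolean_shift mulrDl wD muD mulrDl scalerDr opprD addrACA.
by rewrite /boolean_shift -mulrA wM muM mulrBr -scalerAr mulrA.
Qed.

Section Family.
Variable I : eqType.
Implicit Types (v : I -> ncpoly B -> D).

(** An element of the boolean product of copies of the model is stored as the
    family of its projections on the copies, which share their vacuum
    coefficient.  The variable of index [j] reads the component [j] only; the
    vacuum coefficient of the result is all that the other copies see. *)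
Definition var_op (j : I) v : I -> ncpoly B -> D :=
  fun i g => if i == j then boolean_shift (v j) g else mu g * boolean_shift (v j) 1.

Definition const_op (b : B) v : I -> ncpoly B -> D :=
  fun i g => v i (g * fa_const b).

Definition coherent v :=
  (forall i, left_linear (v i)) /\ (forall i j, v i 1 = v j 1).

Fixpoint term_act (s : fterm B I) v : I -> ncpoly B -> D :=
  match s with
  | FVar j => var_op j v
  | FConst b => const_op b v
  | FAdd s u => fun i g => term_act s v i g + term_act u v i g
  | FMul s u => term_act s (term_act u v)
  end.

Lemma coherent_var j v : coherent v -> coherent (var_op j v).
Proof.
move=> [vL v1]; have [muD muM] := left_linear_mu; split=> i.
  rewrite /var_op; case: eqP => _; first exact: left_linear_boolean_shift.
  by split=> [g h|b g]; rewrite ?muD ?muM (mulrDl, mulrA).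
by move=> k; rewrite /var_op mu1 mul1r; case: ifP; case: ifP.
Qed.

Lemma coherent_const b v : coherent v -> coherent (const_op b v).
Proof.
move=> [vL v1]; split=> [i|i j].
  have [vD vM] := vL i; split=> [g h|b' g]; rewrite /const_op.
    by rewrite mulrDl vD.
  by rewrite -mulrA vM.
rewrite /const_op !mul1r (left_linear_const b (vL i)).
by rewrite (left_linear_const b (vL j)) (v1 i j).
Qed.

Lemma coherent_act s v : coherent v -> coherent (term_act s v).
Proof.
elim: s v => [j|b|s IHs u IHu|s IHs u IHu] v cv /=.
- exact: coherent_var.
- exact: coherent_const.
- have [sL s1] := IHs v cv; have [uL u1] := IHu v cv.
  split=> [i|i j]; last by rewrite (s1 i j) (u1 i j).
  have [sD sM] := sL i; have [uD uM] := uL i; split=> [g h|b g].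
    by rewrite sD uD addrACA.
  by rewrite sM uM mulrDr.
by apply/IHs/IHu.
Qed.

Lemma term_actD s v v' :
  term_act s (fun i g => v i g + v' i g) =
  (fun i g => term_act s v i g + term_act s v' i g).
Proof.
elim: s v v' => [j|b|s IHs u IHu|s IHs u IHu] v v' //=.
- apply/funext => i; apply/funext => g; rewrite /var_op.
  have sD h : boolean_shift (fun g => v j g + v' j g) h =
      boolean_shift (v j) h + boolean_shift (v' j) h.
    by rewrite /boolean_shift mulrDr scalerDr opprD addrACA.
  by case: ifP => _; rewrite !sD ?mulrDr.
- apply/funext => i; apply/funext => g.
  by rewrite IHs IHu addrACA.
by rewrite IHu IHs.
Qed.

Lemma term_actM s v d :
  term_act s (fun i g => v i g * d) = (fun i g => term_act s v i g * d).
Proof.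
elim: s v => [j|b|s IHs u IHu|s IHs u IHu] v //=.
- apply/funext => i; apply/funext => g; rewrite /var_op.
  have sM h : boolean_shift (fun g => v j g * d) h = boolean_shift (v j) h * d.
    by rewrite /boolean_shift mulrBl -scalerAl mulrA.
  by case: ifP => _; rewrite !sM ?mulrA.
- apply/funext => i; apply/funext => g.
  by rewrite IHs IHu mulrDl.
by rewrite IHu IHs.
Qed.

(** The operators satisfy the defining relations of the free algebra, but only
    on coherent families: additivity in the constants uses additivity of the
    components, and centrality of the scalars uses left linearity together with
    the compatibility of the action with right multiplication by [D]. *)
Lemma term_act_feq s u v : feq s u -> coherent v -> term_act s v = term_act u v.
Proof.
move=> su; elim: su v => {s u} /=.
- by [].
- by move=> s u _ IH v cv; rewrite IH.
- by move=> s u w _ IH1 _ IH2 v cv; rewrite IH1 // IH2.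
- by move=> s s' u u' _ IH1 _ IH2 v cv; rewrite IH1 // IH2.
- by move=> s s' u u' _ IH1 _ IH2 v cv; rewrite IH2 // IH1 //; apply: coherent_act.
- by move=> s u w v cv; apply/funext => i; apply/funext => g; rewrite addrA.
- by move=> s u v cv; apply/funext => i; apply/funext => g; rewrite addrC.
- move=> s v cv; apply/funext => i; apply/funext => g.
  by rewrite /const_op rmorph0 mulr0 left_linear0 ?add0r //; case: cv.
- by [].
- move=> s v cv; apply/funext => i; apply/funext => g.
  by rewrite /const_op rmorph1 mulr1.
- move=> s v cv; congr (term_act s _); apply/funext => i; apply/funext => g.
  by rewrite /const_op rmorph1 mulr1.
- by [].
- by move=> s u w v cv; rewrite term_actD.
- move=> s v cv; apply/funext => i; apply/funext => g.
  rewrite /const_op rmorph0 mulr0 !left_linear0 //; first by case: cv.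
  by case: (coherent_act s cv).
- move=> b b' v [vL _]; apply/funext => i; apply/funext => g.
  by rewrite /const_op rmorphD mulrDr; case: (vL i) => ->.
- move=> b b' v cv; apply/funext => i; apply/funext => g.
  by rewrite /const_op rmorphM mulrA.
move=> c s v cv.
have cE w : coherent w -> const_op c%:A w = (fun i g => w i g * c%:A).
  move=> [wL _]; apply/funext => i; apply/funext => g.
  rewrite /const_op [g * _](esym (fa_scalarC c g)).
  have [_ ->] := wL i; rewrite linearZ /= rmorph1.
  by rewrite mulr_algl mulr_algr.
by rewrite !cE ?term_actM //; apply: coherent_act.
Qed.

Definition act (f : freeAlg B I) v := term_act (repr f) v.

Lemma act_pi s v : coherent v -> act (\pi s)%qT v = term_act s v.
Proof. by move=> cv; apply: term_act_feq => //; apply: feq_repr. Qed.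

Lemma coherentA f v : coherent v -> coherent (act f v).
Proof. exact: coherent_act. Qed.

Lemma act_var j v : coherent v -> act (fa_var j) v = var_op j v.
Proof. exact: act_pi. Qed.

Lemma act_const b v : coherent v -> act (fa_const b) v = const_op b v.
Proof. exact: act_pi. Qed.

Lemma actD f h v : coherent v ->
  act (f + h) v = (fun i g => act f v i g + act h v i g).
Proof. exact: act_pi. Qed.

Lemma actM f h v : coherent v -> act (f * h) v = act f (act h v).
Proof. exact: act_pi. Qed.

Lemma act_rscale f v d :
  act f (fun i g => v i g * d) = (fun i g => act f v i g * d).
Proof. exact: term_actM. Qed.

Lemma act0 v i g : coherent v -> act 0 v i g = 0.
Proof.
move=> cv; rewrite -[0]/(fa_const 0) act_const // /const_op rmorph0 mulr0.
by apply: left_linear0; case: cv.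
Qed.

Lemma act1 v : coherent v -> act 1 v = v.
Proof.
move=> cv; rewrite -[1]/(fa_const 1) act_const //.
by apply/funext => i; apply/funext => g; rewrite /const_op rmorph1 mulr1.
Qed.

Definition vacuum : I -> ncpoly B -> D := fun _ => mu.

Lemma coherent_vacuum : coherent vacuum.
Proof. by split=> // i; apply: left_linear_mu. Qed.

Lemma coherent_rscale v d : coherent v -> coherent (fun i g => v i g * d).
Proof.
move=> [vL v1]; split=> [i|i j]; last by rewrite (v1 i j).
by have [vD vM] := vL i; split=> [g h|b g]; rewrite ?vD ?vM (mulrDl, mulrA).
Qed.

Definition vacuum_state (i : I) (f : freeAlg B I) : D := act f vacuum i 1.

Lemma vacuum_state_bimodule i : bimodule_map iota (vacuum_state i).
Proof.
have cvac := coherent_vacuum.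
have actL f b : vacuum_state i (fa_const b * f) = iota b * vacuum_state i f.
  rewrite /vacuum_state actM // act_const; last exact: coherentA.
  rewrite /const_op mul1r left_linear_const //.
  by case: (coherentA f cvac).
have state_constr f b : vacuum_state i (f * fa_const b) = vacuum_state i f * iota b.
  rewrite /vacuum_state actM // act_const //.
  have -> : const_op b vacuum = (fun j g => vacuum j g * iota b).
    by apply/funext => j; apply/funext => g; rewrite /const_op /vacuum mu_constr.
  by rewrite act_rscale.
split=> [c f h|b f b']; last by rewrite state_constr actL.
rewrite {1}/vacuum_state actD //; congr (_ + _).
rewrite -[RHS]mulr_algl -[c%:A](_ : iota c%:A = _); last by rewrite linearZ /= rmorph1.
exact: actL.
Qed.

Lemma vacuum_state1 i : vacuum_state i 1 = 1.
Proof. by rewrite /vacuum_state act1 //; exact: coherent_vacuum. Qed.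

End Family.

Section Independence.
Variables (N : nat).
Notation vac := (@vacuum 'I_N).

Lemma act_prod_local (j : 'I_N) (bs : seq B) v v' : coherent v -> coherent v' ->
  v j = v' j ->
  act (\prod_(b <- bs) (fa_var j * fa_const b)) v j =
  act (\prod_(b <- bs) (fa_var j * fa_const b)) v' j.
Proof.
move=> cv cv' vj; elim: bs => [|b bs IH]; first by rewrite big_nil !act1.
rewrite big_cons !actM //; do ?[exact: coherentA].
set w := act _ v in IH *; set w' := act _ v' in IH *.
have cw : coherent w by apply: coherentA.
have cw' : coherent w' by apply: coherentA.
rewrite !act_const // !act_var; do ?[exact: coherent_const].
by apply/funext => g; rewrite /var_op eqxx /boolean_shift /const_op IH.
Qed.

Lemma act_monomial_local (j : 'I_N) b0 bs v v' : coherent v -> coherent v' ->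
  v j = v' j -> act (monomial j b0 bs) v j = act (monomial j b0 bs) v' j.
Proof.
move=> cv cv' vj; rewrite !actM // !act_const; do ?[exact: coherentA].
by rewrite /const_op (act_prod_local bs cv cv' vj).
Qed.

Lemma act_monomial_off (i j : 'I_N) b0 bs v g : coherent v -> bs != [::] ->
  i != j -> act (monomial j b0 bs) v i g = mu g * act (monomial j b0 bs) v i 1.
Proof.
case: bs => // b bs cv _ ij; rewrite actM // big_cons actM // actM; last first.
  exact: coherentA.
set w := act _ v; have cw : coherent w by apply: coherentA.
have cw' : coherent (const_op b w) by apply: coherent_const.
rewrite [act (fa_const b) _]act_const // act_var // act_const; last first.
  exact: coherent_var.
rewrite /const_op /var_op (negPf ij) !mu_constr mu1 mul1r.
by rewrite !mulrA.
Qed.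

Lemma act_no_free_term_local (j : 'I_N) f v v' : coherent v -> coherent v' ->
  no_free_term j f -> v j = v' j -> act f v j = act f v' j.
Proof.
move=> cv cv' [ws _ ->] vj; elim: ws => [|w ws IH].
  by rewrite big_nil; apply/funext => g; rewrite !act0.
by rewrite big_cons !actD // IH (act_monomial_local _ _ cv cv' vj).
Qed.

Lemma act_no_free_term_off (i j : 'I_N) f v g : coherent v ->
  no_free_term j f -> i != j -> act f v i g = mu g * act f v i 1.
Proof.
move=> cv [ws + ->] ij; elim: ws => [_|w ws IH /= /andP[w0 wsP]].
  by rewrite big_nil !act0 // mulr0.
by rewrite big_cons !actD // IH // mulrDr act_monomial_off.
Qed.

(** On a family whose component [j] lies on the vacuum line, an element of the
    algebra of [X_j] with no free term produces a family whose other components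
    lie on the vacuum line: its last operation is a variable [X_j], followed by
    a constant. *)
Lemma act_no_free_term (j : 'I_N) f v d : coherent v -> no_free_term j f ->
  (forall g, v j g = mu g * d) ->
  (forall i, act f v i 1 = vacuum_state i f * d) /\
  (forall i g, i != j -> act f v i g = mu g * (vacuum_state i f * d)).
Proof.
move=> cv fj vj; have cvac := coherent_vacuum 'I_N.
have at1 i : act f v i 1 = vacuum_state i f * d.
  have [_ Ev] := coherentA f cv; have [_ E] := coherentA f cvac.
  rewrite /vacuum_state (Ev i j) (E i j).
  rewrite (@act_no_free_term_local j f v (fun i g => vac i g * d)) //.
  - by rewrite act_rscale.
  - exact: coherent_rscale.
  - by apply/funext => g; apply: vj.
by split=> // i g ij; rewrite (act_no_free_term_off g cv fj) // at1.
Qed.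

(** Each factor meets a family whose component of its index lies on the vacuum
    line, because the preceding factor has a different index. *)
Lemma act_alternating m (eps : 'I_m.+1 -> 'I_N) (A : 'I_m.+1 -> ncpolyn B N) i0 :
  (forall k l : 'I_m.+1, l = k.+1 :> nat -> eps k != eps l) ->
  (forall k, no_free_term (eps k) (A k)) ->
  let d := \prod_(k < m.+1) vacuum_state i0 (A k) in
  let v := act (\prod_(k < m.+1) A k) vac in
  (forall i, v i 1 = d) /\ (forall i g, i != eps ord0 -> v i g = mu g * d).
Proof.
have cvac := coherent_vacuum 'I_N.
have indep i f : vacuum_state i f = vacuum_state i0 f.
  by rewrite /vacuum_state; have [_ /(_ i i0) ->] := coherentA f cvac.
elim: m eps A => [|m IH] eps A alt AP d v.
  rewrite /d /v !big_ord1.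
  have [|h1 h2] := act_no_free_term (d := 1) cvac (AP ord0).
    by move=> g; rewrite mulr1.
  by split=> [i|i g ie]; rewrite ?h1 ?h2 // mulr1 (indep i).
have [] := IH (fun k => eps (lift ord0 k)) (fun k => A (lift ord0 k)).
- by move=> k l kl; apply: alt; rewrite !lift0 kl.
- by move=> k; apply: AP.
move=> _ off.
rewrite {}/v {}/d big_ord_recl actM // [\prod_(k < m.+2) _]big_ord_recl.
set w := act _ vac in off *; set e := \prod_(_ < _) _ in off *.
have cw : coherent w by apply: coherentA.
have [|h1 h2] := act_no_free_term (d := e) cw (AP ord0).
  by move=> g; apply: off; apply: alt; rewrite lift0.
by split=> [i|i g ie]; rewrite ?h1 ?h2 // (indep i).
Qed.

Lemma vacuum_state_independent i0 :
  boolean_independent (@vacuum_state 'I_N i0).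
Proof.
move=> [//|m] eps A _ alt AP.
by have [at1 _] := act_alternating i0 alt AP; apply: at1.
Qed.

Lemma act_subst_var (j : 'I_N) f v : coherent v ->
  act (subst_var j f) v j = act f (fun _ : unit => v j) tt.
Proof.
elim/freeAlg_ind: f v => [[]|b|f h IHf IHh|f h IHf IHh] v cv;
  have cj : coherent (fun _ : unit => v j) by split=> // _; case: cv.
- by rewrite /subst_var fa_lift_var !act_var //; apply/funext => g; rewrite /var_op eqxx.
- by rewrite /subst_var fa_lift_const !act_const.
- by rewrite /subst_var fa_liftD !actD // IHf // IHh.
rewrite /subst_var fa_liftM !actM // IHf; last exact: coherentA.
rewrite -/(subst_var j h) IHh //; congr (act f _ tt).
by apply/funext => -[].
Qed.

Lemma vacuum_state_subst_var (j i : 'I_N) f :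
  vacuum_state i (subst_var j f) = vacuum_state tt f.
Proof.
have cvac := coherent_vacuum 'I_N.
rewrite /vacuum_state; have [_ /(_ i j)->] := coherentA (subst_var j f) cvac.
by rewrite act_subst_var.
Qed.

(** The operator [t + (1 - t) P]. *)
Definition compress (w : ncpoly B -> D) : ncpoly B -> D :=
  fun g => t%:C *: w g + (1 - t)%:C *: (mu g * w 1).

Lemma compress1 w : compress w 1 = w 1.
Proof. by rewrite /compress mu1 mul1r -scalerDl -rmorphD addrC subrK scale1r. Qed.

Lemma left_linear_compress w : left_linear w -> left_linear (compress w).
Proof.
move=> [wD wM]; have [muD muM] := left_linear_mu; split=> [g h|b g].
  by rewrite /compress wD muD mulrDl !scalerDr addrACA.
by rewrite /compress wM muM mulrDr -!scalerAr mulrA.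
Qed.

Lemma boolean_shift_compress w g : boolean_shift (compress w) g = t%:C *: w (g * X).
Proof. by rewrite /boolean_shift compress1 /compress addrK. Qed.

Hypothesis tN : t * N%:R = 1.

(** The sum of the variables preserves the families with equal components
    [compress w].  The [N - 1] variables foreign to a copy contribute on the
    vacuum line the fraction [(N - 1) t = 1 - t] of the vacuum coefficient of
    [X w]. *)
Lemma act_subst_sum f w : left_linear w ->
  act (subst_sum N f) (fun _ => compress w) =
  (fun _ => compress (fun g => w (g * f))).
Proof.
have cc w' : left_linear w' -> coherent (fun _ : 'I_N => compress w').
  by move=> w'L; split=> // _; apply: left_linear_compress.
have lr h w' : left_linear w' -> left_linear (fun g => w' (g * h)).
  move=> [wD wM]; split=> [g g'|b g]; first by rewrite mulrDl wD.
  by rewrite -mulrA wM.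
elim/freeAlg_ind: f w => [[]|b|f h IHf IHh|f h IHf IHh] w wL.
- rewrite /subst_sum fa_lift_var; apply/funext => i; apply/funext => g.
  have -> : act (\sum_(j < N) fa_var j) (fun _ => compress w) i g =
      \sum_(j < N) var_op j (fun _ => compress w) i g.
    elim: (index_enum _) => [|j s IH]; first by rewrite !big_nil act0 //; apply: cc.
    rewrite !big_cons actD; last exact: cc.
    by rewrite IH act_var //; apply: cc.
  rewrite (bigD1 i) //= {1}/var_op eqxx.
  have -> : \sum_(j < N | j != i) var_op j (fun _ => compress w) i g =
      (1 - t)%:C *: (mu g * w (1 * X)).
    under eq_bigr => j ji do
      rewrite /var_op eq_sym (negPf ji) boolean_shift_compress -scalerAr.
    rewrite sumr_const (cardC1 i) card_ord -scaler_nat scalerA; congr (_ *: _).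
    rewrite -(rmorph_nat (real_complex R)) -rmorphM; congr (_%:C).
    have N0 : (0 < N)%N by apply: leq_trans (ltn_ord i).
    by rewrite -subn1 natrB // mulrBl mul1r mulrC tN.
  by rewrite boolean_shift_compress.
- rewrite /subst_sum fa_lift_const act_const; last exact: cc.
  apply/funext => i; apply/funext => g; rewrite /const_op /compress.
  by rewrite mu_constr mul1r left_linear_const // mulrA.
- rewrite /subst_sum fa_liftD actD; last exact: cc.
  rewrite -!/(subst_sum N _) IHf // IHh //; apply/funext => i; apply/funext => g.
  rewrite /compress addrACA -!scalerDr -mulrDr.
  by have [wD _] := wL; rewrite [g * (f + h)]mulrDr [1 * (f + h)]mulrDr !wD.
rewrite /subst_sum fa_liftM actM; last exact: cc.
rewrite -!/(subst_sum N _) IHh // IHf; last exact: lr.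
by apply/funext => i; apply/funext => g; rewrite /compress !mulrA.
Qed.

Lemma vacuum_state_subst_sum (i : 'I_N) f :
  vacuum_state i (subst_sum N f) = mu f.
Proof.
have E : vac = (fun _ => compress mu).
  apply/funext => j; apply/funext => g; rewrite /compress mu1 mulr1.
  by rewrite -scalerDl -rmorphD addrC subrK scale1r.
rewrite /vacuum_state E act_subst_sum ?compress1 ?mul1r //.
exact: left_linear_mu.
Qed.

End Independence.
End BooleanModel.

(** * Complete positivity of the boolean power *)

Section Positivity.
Variables (R : realType) (B D : cstarAlgType R) (iota : {lrmorphism B -> D}).
Hypothesis iota_star : forall b : B, iota (star b) = star (iota b).
Variables (mu : ncpoly B -> D) (mu_Sigma : Sigma iota mu).

Let mu_bimod : bimodule_map iota mu. Proof. by case: mu_Sigma. Qed.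
Let mu1 : mu 1 = 1. Proof. by case: mu_Sigma. Qed.

Lemma Sigma_gram n (f : 'I_n -> ncpoly B) :
  mx_is_pos (\matrix_(j, i) mu (star (f j) * f i)).
Proof.
case: n f => [|n] f; first by exists 0; rewrite [LHS]thinmx0 [RHS]thinmx0.
by case: mu_Sigma => _ _ _; apply.
Qed.

(** Read off the self-adjointness of the Gram matrix of [1] and [f]. *)
Lemma Sigma_hermitian f : mu (star f) = star (mu f).
Proof.
have [Z MZ] := Sigma_gram (fun k : 'I_2 => if k == 0 then 1 else f).
have herm := mx_starM (mx_star Z) Z; rewrite mx_starK -MZ in herm.
by move/matrixP/(_ 1 0): herm; rewrite !mxE /= mulr1 star1 mul1r => <-.
Qed.

Notation X := (fa_var tt : ncpoly B).
Notation tensor := (seq (ncpoly B * D)).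

(** The vector [sum of f d] over the pairs [(f, d)] of the list, in its
    representation [g |-> <1, g u>]; [pairing l w] is the inner product of that
    vector with the one represented by [w]. *)
Definition ket (l : tensor) : ncpoly B -> D :=
  fun g => \sum_(p <- l) mu (g * p.1) * p.2.

Definition pairing (l : tensor) (w : ncpoly B -> D) : D :=
  \sum_(p <- l) star p.2 * w (star p.1).

Lemma left_linear_ket l : left_linear iota (ket l).
Proof.
have [muD muM] := left_linear_mu mu_bimod; split=> [g h|b g].
  by rewrite /ket -big_split; apply: eq_bigr => p _; rewrite mulrDl muD mulrDl.
by rewrite /ket mulr_sumr; apply: eq_bigr => p _; rewrite -mulrA muM mulrA.
Qed.

Lemma ket_cat l m g : ket (l ++ m) g = ket l g + ket m g.
Proof. exact: big_cat. Qed.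

Lemma ket1 f d g : ket [:: (f, d)] g = mu (g * f) * d.
Proof. exact: big_seq1. Qed.

Lemma pairing_cat l m w : pairing (l ++ m) w = pairing l w + pairing m w.
Proof. exact: big_cat. Qed.

Lemma pairing1 f d w : pairing [:: (f, d)] w = star d * w (star f).
Proof. exact: big_seq1. Qed.

Lemma pairing_ket_sym l m : pairing l (ket m) = star (pairing m (ket l)).
Proof.
rewrite /pairing /ket star_sum.
under eq_bigr => p _ do rewrite mulr_sumr.
rewrite exchange_big; apply: eq_bigr => q _ /=; rewrite starM starK star_sum.
rewrite mulr_suml; apply: eq_bigr => p _.
by rewrite starM -Sigma_hermitian starM starK mulrA.
Qed.

Lemma pairing_mu l d : pairing l (fun g => mu g * d) = star (ket l 1) * d.
Proof.
rewrite /pairing /ket star_sum mulr_suml; apply: eq_bigr => p _.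
by rewrite starM mul1r -Sigma_hermitian mulrA.
Qed.

Lemma pairingB l w w' :
  pairing l (fun g => w g - w' g) = pairing l w - pairing l w'.
Proof. by rewrite /pairing -sumrB; apply: eq_bigr => p _; rewrite mulrBr. Qed.

Lemma pairingZ l w (c : R[i]) :
  pairing l (fun g => c *: w g) = c *: pairing l w.
Proof.
by rewrite /pairing scaler_sumr; apply: eq_bigr => p _; rewrite scalerAr.
Qed.

Variables (N : nat) (t : R).
Hypothesis (tN : t * N%:R = 1).

Notation r := (N%:R : R).
Let rt : r * (1 - t) = r - 1. Proof. by rewrite mulrBr mulr1 mulrC tN. Qed.

(** The form [N <u, v> - (N - 1) <u, 1> <1, v>], for which [boolean_shift] is
    symmetric. *)
Definition form (l : tensor) (w : ncpoly B -> D) : D :=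
  r%:C *: pairing l w - (r - 1)%:C *: (star (ket l 1) * w 1).

(** Two lists representing the same vector have the same pairing with every
    vector of the module, by hermitian symmetry. *)
Lemma form_ket_eq l l' m : ket l = ket l' -> form l (ket m) = form l' (ket m).
Proof.
by move=> ll'; rewrite /form !(pairing_ket_sym _ m) ll'.
Qed.

Lemma form_unit w : form [:: (1, 1)] w = w 1.
Proof.
rewrite /form pairing1 ket1 star1 !mul1r star1 mu1 mulr1 star1 mul1r.
by rewrite -scalerBl -rmorphB subKr scale1r.
Qed.

(** The action of [B<X>] on a single copy of the model. *)
Definition lact (f w : _) : ncpoly B -> D :=
  act mu t (I := unit) f (fun _ => w) tt.

Let coh w : left_linear iota w -> coherent iota (fun _ : unit => w).
Proof. by move=> wL; split. Qed.

Lemma lact_var w : left_linear iota w -> lact X w = boolean_shift mu t w.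
Proof. by move=> wL; rewrite /lact (act_var mu_bimod mu1) //; exact: coh. Qed.

Lemma lact_const b w : left_linear iota w ->
  lact (fa_const b) w = (fun g => w (g * fa_const b)).
Proof. by move=> wL; rewrite /lact (act_const mu_bimod mu1) //; exact: coh. Qed.

Lemma lactD f h w : left_linear iota w ->
  lact (f + h) w = (fun g => lact f w g + lact h w g).
Proof. by move=> wL; rewrite /lact (actD mu_bimod mu1) //; exact: coh. Qed.

Lemma lactM f h w : left_linear iota w -> lact (f * h) w = lact f (lact h w).
Proof.
move=> wL; rewrite /lact (actM mu_bimod mu1); last exact: coh.
by congr (act _ _ f _ tt); apply/funext => -[].
Qed.

Lemma lact_ket f l : exists l', ket l' = lact f (ket l).
Proof.
elim/freeAlg_ind: f l => [[]|b|f h IHf IHh|f h IHf IHh] l;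
  have lL := left_linear_ket l.
- exists ([seq (X * p.1, p.2) | p <- l] ++
          [:: (X, - ((1 - t)%:C *: ket l 1))]).
  rewrite lact_var //; apply/funext => g.
  rewrite ket_cat ket1 mulrN -scalerAr; congr (_ - _).
  by rewrite /ket big_map; apply: eq_bigr => p _; rewrite mulrA.
- exists [seq (fa_const b * p.1, p.2) | p <- l].
  rewrite lact_const //; apply/funext => g.
  by rewrite /ket big_map; apply: eq_bigr => p _; rewrite mulrA.
- have [l1 E1] := IHf l; have [l2 E2] := IHh l; exists (l1 ++ l2).
  by rewrite lactD // -E1 -E2; apply/funext => g; rewrite ket_cat.
by have [l1 E1] := IHh l; have [l2 E2] := IHf l1; exists l2; rewrite lactM // -E1.
Qed.

(** Both sides differ from the undeformed identity by multiples of
    [<u, 1> <X 1, v>] and [<u, X 1> <1, v>], which balance because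
    [N (1 - t) = N - 1]. *)
Lemma form_adjoint_var l m :
  form ([seq (X * p.1, p.2) | p <- l] ++ [:: (X, - ((1 - t)%:C *: ket l 1))])
    (ket m) = form l (boolean_shift mu t (ket m)).
Proof.
have XE : star X = X by apply: star_var.
set w := ket m; set e := ket l 1; set l1 := map _ l.
have l1X : ket l1 1 = ket l X.
  by rewrite /ket big_map; apply: eq_bigr => p _; rewrite mul1r.
have wX : pairing l1 w = pairing l (fun g => w (g * X)).
  by rewrite /pairing big_map; apply: eq_bigr => p _; rewrite starM XE.
have muX : pairing l (fun g => mu (g * X) * w 1) = star (ket l X) * w 1.
  rewrite /pairing /ket star_sum mulr_suml; apply: eq_bigr => p _.
  by rewrite starM -Sigma_hermitian starM XE mulrA.
rewrite /form pairing_cat ket_cat pairing1 ket1 wX l1X XE mul1r.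
rewrite /boolean_shift pairingB pairingZ muX -/e !mul1r.
have sX : star (mu X) = mu X by rewrite -Sigma_hermitian XE.
rewrite starN starZr starD starM starN starZr sX.
set P := pairing _ _; set u := star (ket l X); set a := star e.
rewrite !mulNr [in LHS]mulrDl mulNr -!scalerAl mulrBr -scalerAr !mulrA.
rewrite !scalerBr !scalerA -!rmorphM rt !opprB.
by rewrite addrACA [RHS]addrACA; congr (_ + _); rewrite addrC.
Qed.

Lemma form_adjoint_const b l m :
  form [seq (fa_const b * p.1, p.2) | p <- l] (ket m) =
  form l (fun g => ket m (g * fa_const (star b))).
Proof.
have [_ kM] := left_linear_ket l.
rewrite /form; congr (_ *: _ - _ *: _).
  by rewrite /pairing big_map; apply: eq_bigr => p _; rewrite starM star_const.
rewrite mul1r (left_linear_const (star b) (left_linear_ket m)) iota_star mulrA -starM.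
congr (star _ * _); rewrite -kM /ket big_map; apply: eq_bigr => p _.
by rewrite mulr1 mul1r.
Qed.

(** The action is a star representation.  The vector [f u] enters through an
    arbitrary list [l'] representing it, since [lact f] produces a map and not a
    list. *)
Lemma form_adjoint f l l' m :
  ket l' = lact f (ket l) -> form l' (ket m) = form l (lact (star f) (ket m)).
Proof.
elim/freeAlg_ind: f l l' m => [[]|b|f h IHf IHh|f h IHf IHh] l l' m;
  have lL := left_linear_ket l; have mL := left_linear_ket m.
- move=> E; rewrite star_var lact_var // -form_adjoint_var.
  apply: form_ket_eq; rewrite E lact_var //; apply/funext => g.
  rewrite ket_cat ket1 mulrN -scalerAr; congr (_ - _).
  by rewrite /ket big_map; apply: eq_bigr => p _; rewrite mulrA.
- move=> E; rewrite star_const lact_const // -form_adjoint_const.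
  apply: form_ket_eq; rewrite E lact_const //; apply/funext => g.
  by rewrite /ket big_map; apply: eq_bigr => p _; rewrite mulrA.
- have [l1 E1] := lact_ket f l; have [l2 E2] := lact_ket h l.
  rewrite lactD // -E1 -E2 starD lactD // => E.
  rewrite (@form_ket_eq _ (l1 ++ l2)); last first.
    by rewrite E; apply/funext => g; rewrite ket_cat.
  have formD w w' : form l (fun g => w g + w' g) = form l w + form l w'.
    rewrite /form addrACA -opprD -!scalerDr -mulrDr /pairing -big_split /=.
    by under [in RHS]eq_bigr => p _ do rewrite -mulrDr.
  rewrite formD -(IHf _ _ _ E1) -(IHh _ _ _ E2) /form pairing_cat ket_cat.
  by rewrite starD mulrDl !scalerDr opprD addrACA.
have [l1 E1] := lact_ket h l; rewrite lactM // -E1 => E.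
have [m1 E2] := lact_ket (star f) m.
by rewrite (IHf _ _ _ E) starM lactM // -E2 (IHh _ _ _ E1).
Qed.

Definition off_vacuum (l : tensor) : tensor := l ++ [:: (1, - ket l 1)].

(** Splitting off the vacuum component shows that the form is positive. *)
Lemma form_gram l m :
  form l (ket m) = r%:C *: pairing (off_vacuum l) (ket (off_vacuum m)) +
                   star (ket l 1) * ket m 1.
Proof.
have kE : ket (off_vacuum m) = (fun g => ket m g - mu g * ket m 1).
  by apply/funext => g; rewrite ket_cat ket1 mulr1 mulrN.
rewrite kE pairing_cat pairing1 star1 mu1 mul1r subrr mulr0 addr0.
rewrite pairingB pairing_mu /form scalerBr -addrA; congr (_ + _).
by rewrite rmorphB scalerBl scale1r opprB addrC.
Qed.

(** Concatenate the lists; the Gram matrix of all their polynomials is a square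
    by complete positivity of [mu], and the coefficients in [D] form the
    rectangular matrix [V]. *)
Lemma pairing_gram n (l : 'I_n -> tensor) : exists p, exists W : 'M[D]_(p, n),
  \matrix_(j, i) pairing (l j) (ket (l i)) = mx_star W *m W.
Proof.
pose L := flatten [seq [seq (i, p) | p <- l i] | i <- enum 'I_n].
have sumL (G : ncpoly B * D -> D) j :
    \sum_(x <- L) (if x.1 == j then G x.2 else 0) = \sum_(p <- l j) G p.
  rewrite big_flatten big_map big_enum (bigD1 j) //= big_map.
  rewrite [X in _ + X]big1 ?addr0 => [|i ij].
    by apply: eq_bigr => p _; rewrite eqxx.
  by rewrite big_map big1 // => p _; rewrite /= (negPf ij).
pose F k := tnth (in_tuple L) k.
have [Z MZ] := Sigma_gram (fun k => (F k).2.1).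
pose V : 'M[D]_(size L, n) := \matrix_(k, i) if (F k).1 == i then (F k).2.2 else 0.
exists (size L), (Z *m V); rewrite mx_starM mulmxA -[_ *m _ *m Z]mulmxA -MZ.
apply/matrixP => j i; rewrite !mxE /pairing -sumL big_tnth.
under [RHS]eq_bigr => k _ do rewrite !mxE mulr_suml.
rewrite exchange_big; apply: eq_bigr => k _ /=; rewrite -/(F k).
transitivity (\sum_k' (if (F k).1 == j then star (F k).2.2 else 0) *
   mu (star (F k).2.1 * (F k').2.1) *
   (if (F k').1 == i then (F k').2.2 else 0)).
  case: ifP => _; last by rewrite big1 // => k' _; rewrite !mul0r.
  rewrite /ket -sumL big_tnth mulr_sumr; apply: eq_bigr => k' _.
  by rewrite -/(F k'); case: ifP => _; rewrite ?mulr0 ?mulrA.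
apply: eq_bigr => k' _; rewrite !mxE.
by case: ifP => _; rewrite ?star0.
Qed.

(** By adjunction the entries are [form (f j 1) (f i 1)], and [form_gram]
    stacks the factor for the orthogonal of the vacuum, scaled by the square
    root of [N], on the row of vacuum coefficients. *)
Lemma vacuum_state_gram n (f : 'I_n -> ncpoly B) :
  mx_is_pos (\matrix_(j, i) vacuum_state mu t tt (star (f j) * f i)).
Proof.
have mL := left_linear_mu mu_bimod.
have ket0 : ket [:: (1, 1)] = mu by apply/funext => g; rewrite ket1 !mulr1.
have [l lE] := choice (fun i => lact_ket (f i) [:: (1, 1)]).
have [p [W WE]] := pairing_gram (fun i => off_vacuum (l i)).
pose e : 'M[D]_(1, n) := \row_i ket (l i) 1.
pose W' := col_mx (cstar_scalar D (Num.sqrt r) *: W) e.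
suff -> : \matrix_(j, i) vacuum_state mu t tt (star (f j) * f i) =
    mx_star W' *m W' by apply: mx_gram_pos.
have -> : mx_star W' *m W' = cstar_scalar D r *: (mx_star W *m W) + mx_star e *m e.
  rewrite /W' {1}/mx_star map_col_mx tr_col_mx mul_row_col; congr (_ + _).
  rewrite -/(mx_star _) mx_starZ -scalemxAl mulmx_cscaler scalerA -rmorphM -expr2.
  by rewrite sqr_sqrtr.
rewrite -WE; apply/matrixP => j i; rewrite !mxE big_ord1 !mxE cstar_scalarE.
by rewrite -form_gram (form_adjoint _ (lE j)) form_unit lE -lactM ket0.
Qed.

Lemma vacuum_state_Sigma : Sigma iota (vacuum_state mu t tt).
Proof.
split=> [||f|n f _].
- exact: vacuum_state_bimodule.
- exact: (vacuum_state1 mu_bimod).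
- have [Z /matrixP/(_ 0 0)] := vacuum_state_gram (fun _ : 'I_1 => f).
  by rewrite !mxE big_ord1 !mxE => ->; exists (Z 0 0).
exact: vacuum_state_gram.
Qed.

End Positivity.

Theorem theorem2p5 (R : realType) (B D : cstarAlgType R)
    (iota : {lrmorphism B -> D})
    (iota_inj : injective iota)
    (iota_star : forall b : B, iota (star b) = star (iota b))
    (mu : ncpoly B -> D) (mu_Sigma : Sigma iota mu)
    (N : nat) (N_gt0 : (0 < N)%N) :
  exists muN : ncpoly B -> D,
    Sigma iota muN /\
    is_boolean_convolution iota (fun _ : 'I_N => muN) mu.
Proof.
pose t : R := N%:R^-1.
have tN : t * N%:R = 1 by rewrite mulVf // pnatr_eq0 -lt0n.
have [mu_bimod mu1 _ _] := mu_Sigma; pose i0 := Ordinal N_gt0.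
exists (vacuum_state mu t tt); split; first exact: vacuum_state_Sigma tN.
exists (vacuum_state mu t i0); split.
- split; first exact: vacuum_state_bimodule.
  exact: (vacuum_state1 mu_bimod).
- by move=> j f; apply: (vacuum_state_subst_var mu_bimod mu1).
- exact: (vacuum_state_independent mu_bimod).
by move=> f; rewrite (vacuum_state_subst_sum mu_bimod mu1 tN).
Qed.
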